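(* Let $P=P_m+\cdots+P_0\in\mathbb C[x_1,\dots,x_d]$, $m\ge3$, $P_k$ homogeneous of degree $k$, be such that $\partial_1P_m(x)=\cdots=\partial_dP_m(x)=0$ implies $x=0$. Let $\mathcal J_m(P)=\mathbb C[x]/(\partial_1P_m,\dots,\partial_dP_m)$, $\mu=\dim_{\mathbb C}\mathcal J_m(P)=(m-1)^d$, $K=\mathbb C(t)$. Then there is a contraction of $(\Omega_K^\bullet,\delta_{0,t})$ onto $(\mathcal J_m(P)\otimes K)[-d]$ (concentrated in degree $d$, zero differential): chain maps $\iota:(\mathcal J_m(P)\otimes K)[-d]\to\Omega_K^\bullet$, $\pi:\Omega_K^\bullet\to(\mathcal J_m(P)\otimes K)[-d]$ and $h_t:\Omega_K^\bullet\to\Omega_K^{\bullet-1}$ with $$\delta_{0,t}h_t+h_t\delta_{0,t}=\mathrm{Id}-\iota\pi,\qquad\pi\iota=\mathrm{Id},\qquad h_t^2=\pi h_t=h_t\iota=0,$$ and $h_t$ lowers polynomial degree by $m-1$. The operators $$\pi_{P,t}=\pi(1+\eta_{P,t}h_t)^{-1}=\pi\sum_{k\ge0}(-\eta_{P,t}h_t)^k,\qquad h_{P,t}=h_t(1+\eta_{P,t}h_t)^{-1}$$ are finite on every polynomial form and satisfy $$\nabla_{P,t}h_{P,t}+h_{P,t}\nabla_{P,t}=\mathrm{Id}-\iota\pi_{P,t},\qquad\pi_{P,t}\nabla_{P,t}=0.$$ Consequently $H^p(\Omega_K^\bullet,\nabla_{P,t})=0$ for $p\ne d$ and $H^d(\Omega_K^\bullet,\nabla_{P,t})\simeq\mathcal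 J_m(P)\otimes K$. For every polynomial $f$, $$[f\,\mathrm{vol}_x]_{\nabla_{P,t}}=[\iota\pi_{P,t}(f\,\mathrm{vol}_x)]_{\nabla_{P,t}}.$$ In particular the direct image $H^d(\Omega_K^\bullet,\nabla_{P,t})$ has exact rank $\mu=(m-1)^d$ over $K$.
   Context: $\Omega_K^\bullet=K[x_1,\dots,x_d]\otimes\bigwedge^\bullet(\mathbb C^d)^*$ is the algebra of polynomial differential forms in $x$ over $K=\mathbb C(t)$; $\mathrm{vol}_x=\mathrm dx_1\wedge\cdots\wedge\mathrm dx_d$. With $q(x)=\sum_jx_j^2$ and $F_{P,t}=-\frac12q(x)+itP(x)$, define $$\nabla_{P,t}=\mathrm d_x+\mathrm d_xF_{P,t}\wedge=\mathrm d_x-\sum_jx_j\,\mathrm dx_j\wedge+it\,\mathrm dP\wedge,$$ $$\delta_{0,t}=it\,\mathrm dP_m\wedge,\qquad\eta_{P,t}=\mathrm d_x-\sum_jx_j\,\mathrm dx_j\wedge+it\,\mathrm d(P-P_m)\wedge,$$ so $\nabla_{P,t}=\delta_{0,t}+\eta_{P,t}$. The critical-point condition on $P_m$ is over $x\in\mathbb C^d$. ''Lowers polynomial degree by $m-1$'' refers to the polynomial degree of the coefficients of forms. ''Finite on every polynomial form'' means the geometric series has only finitely many nonzero terms on each form. *)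

(* Defs.v *)
From HB Require Import structures.
From mathcomp Require Import all_boot all_order all_algebra.
From mathcomp Require Import ring_quotient.
From mathcomp Require Import boolp classical_sets cardinality fsbigop reals.
From mathcomp Require Import complex mpoly.
(* Only the canonical instances of [monalg] are imported: its notation
   [{mpoly R[n]}] clashes with the one of [mpoly]. *)
From mathcomp Require monalg.
Import (canonicals, coercions) monalg.

Set Implicit Arguments.
Unset Strict Implicit.
Unset Printing Implicit Defensive.

Import GRing.Theory.
Local Open Scope ring_scope.

Section Quotients.
Variables (A : pzRingType) (V : lmodType A).

Section LmodQuot.
Variable S : submodClosed V.

(* [submodClosed], which also covers semimodules, does not coerce to the
   [zmodClosed] that [Quotient.quot] expects. *)
Definition submod_pred : {pred V} := S.

Fact submod_pred_zmod_closed : zmod_closed submod_pred.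
Proof.
split=> [|u v Su Sv]; first exact: (rpred0 S).
by rewrite -scaleN1r; apply: (@rpredD _ S) => //; apply: (@rpredZ _ _ S).
Qed.

HB.instance Definition _ :=
  GRing.isZmodClosed.Build V submod_pred submod_pred_zmod_closed.

Definition lmod_quot : Type := Quotient.quot submod_pred.

HB.instance Definition _ := GRing.Zmodule.on lmod_quot.

Definition quot_class (v : V) : lmod_quot := (\pi_(Quotient.quot submod_pred))%qT v.

Definition quot_scale (a : A) (x : lmod_quot) : lmod_quot :=
  quot_class (a *: repr (x : Quotient.quot submod_pred)).

Lemma quot_classP u v : quot_class u = quot_class v <-> u - v \in S.
Proof.
rewrite /quot_class; split=> [/eqP|uv].
  by rewrite -Quotient.idealrBE.
by apply/eqP; rewrite -Quotient.idealrBE.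
Qed.

Lemma quot_class_surj (x : lmod_quot) : exists v, x = quot_class v.
Proof. by exists (repr (x : Quotient.quot submod_pred)); rewrite /quot_class reprK. Qed.

Lemma quot_classD u v : quot_class (u + v) = quot_class u + quot_class v.
Proof. exact: Quotient.pi_add. Qed.

Lemma quot_scaleE a v : quot_scale a (quot_class v) = quot_class (a *: v).
Proof.
apply/quot_classP; rewrite -scalerBr; apply: (@rpredZ _ _ S).
by apply/quot_classP; rewrite /quot_class reprK.
Qed.

Fact quot_scaleA a b x : quot_scale a (quot_scale b x) = quot_scale (a * b) x.
Proof.
by have [v ->] := quot_class_surj x; rewrite !quot_scaleE scalerA.
Qed.

Fact quot_scale1 : left_id 1 quot_scale.
Proof.
by move=> x; have [v ->] := quot_class_surj x; rewrite quot_scaleE scale1r.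
Qed.

Fact quot_scaleDr : right_distributive quot_scale +%R.
Proof.
move=> a x y; have [u ->] := quot_class_surj x.
have [v ->] := quot_class_surj y.
by rewrite -quot_classD !quot_scaleE scalerDr quot_classD.
Qed.

Fact quot_scaleDl x : {morph quot_scale^~ x : a b / a + b}.
Proof.
move=> a b; have [v ->] := quot_class_surj x.
by rewrite !quot_scaleE scalerDl quot_classD.
Qed.

HB.instance Definition _ := GRing.Zmodule_isLmodule.Build A lmod_quot
  quot_scaleA quot_scale1 quot_scaleDr quot_scaleDl.

Fact quot_class_linear : linear quot_class.
Proof. by move=> a u v; rewrite quot_classD -quot_scaleE. Qed.

HB.instance Definition _ :=
  GRing.isLinear.Build A V lmod_quot _ quot_class quot_class_linear.

End LmodQuot.

Definition span (G : set V) : {pred V} := fun v =>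
  `[< exists n (c : 'I_n -> A) (g : 'I_n -> V),
        (forall i, G (g i)) /\ v = \sum_(i < n) c i *: g i >].

Fact span_submod_closed (G : set V) : submod_closed (span G).
Proof.
split=> [|a u v /asboolP[n [c [g [Gg ->]]]] /asboolP[n' [c' [g' [Gg' ->]]]]].
  by apply/asboolP; exists 0%N, (fun=> 0), (fun=> 0); rewrite big_ord0; split=> // -[].
apply/asboolP; exists (n + n')%N.
exists (fun i => match split i with inl j => a * c j | inr j => c' j end).
exists (fun i => match split i with inl j => g j | inr j => g' j end).
split=> [i|]; first by case: split => j.
rewrite big_split_ord scaler_sumr /=; congr (_ + _); apply: eq_bigr => i _.
  by rewrite (unsplitK (inl _ i)) scalerA.
by rewrite (unsplitK (inr _ i)).
Qed.

HB.instance Definition _ (G : set V) :=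
  GRing.isSubmodClosed.Build A V (span G) (span_submod_closed G).

End Quotients.

Section LinearIso.
Variables (F : nzRingType).

Definition linear_iso (U V : lmodType F) : Prop :=
  exists f : {linear U -> V}, bijective f.

(* This is [Vector.axiom], the library's notion of dimension, in [Prop]. *)
Definition has_dim (V : lmodType F) (n : nat) : Prop := linear_iso V 'rV[F]_n.

End LinearIso.

Section BaseChange.
Variables (A K : nzRingType) (phi : {rmorphism A -> K}) (V : lmodType A).

Local Notation free_module := (@monalg.malg V K).
Local Notation gen v := (monalg.mkmalgU v 1 : free_module).

Definition tensor_rel : set free_module := fun w =>
  (exists u v : V, w = gen (u + v) - gen u - gen v) \/
  (exists (c : A) (v : V), w = gen (c *: v) - phi c *: gen v).

(* The tensor product of [V] and [K] over [A], where [K] is an [A]-algebra via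
   [phi], by generators and relations: the generator of index [v] represents
   the tensor of [v] and [1]. *)
Definition base_change := lmod_quot (span tensor_rel).

HB.instance Definition _ := GRing.Lmodule.on base_change.

End BaseChange.

Section Jacobian.
Variables (F : comNzRingType) (d : nat) (p : {mpoly F[d]}).

Definition jacobian_ideal : {pred {mpoly F[d]}} := fun f =>
  `[< exists a : 'I_d -> {mpoly F[d]}, f = \sum_(j < d) a j * p^`M(j) >].

Fact jacobian_ideal_submod_closed : submod_closed jacobian_ideal.
Proof.
split=> [|c u v /asboolP[a ->] /asboolP[b ->]].
  by apply/asboolP; exists (fun=> 0); rewrite big1 // => j _; rewrite mul0r.
apply/asboolP; exists (fun j => c *: a j + b j).
rewrite scaler_sumr -big_split /=; apply: eq_bigr => j _.
by rewrite mulrDl scalerAl.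
Qed.

HB.instance Definition _ := GRing.isSubmodClosed.Build F {mpoly F[d]}
  jacobian_ideal jacobian_ideal_submod_closed.

Definition jacobian_quot := lmod_quot jacobian_ideal.

HB.instance Definition _ := GRing.Lmodule.on jacobian_quot.

End Jacobian.

(* [w I] is the coefficient of dx_(i1) /\ ... /\ dx_(ik) in [w], where
   i1 < ... < ik are the elements of [I]. *)
Notation dform F d := {ffun {set 'I_d} -> {mpoly F[d]}}.

Section Forms.
Variables (F : comNzRingType) (d : nat).
Implicit Types (w a b : dform F d) (f : {mpoly F[d]}) (I J S : {set 'I_d}).

Definition is_form (p : int) w : bool :=
  [forall I, (w I != 0) ==> (#|I|%:Z == p)].

(* For [k < 0] this forces [w = 0]. *)
Definition coef_homog (k : int) w : Prop :=
  forall I, {in msupp (w I), forall u, (mdeg u)%:Z = k}.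

(* The number of transpositions that sort the concatenation of [I] and [J]. *)
Definition inversions I J : nat :=
  #|[set ij in finset.setX I J | (ij.2 < ij.1)%N]|.

Definition wedge a b : dform F d :=
  [ffun S : {set 'I_d} => \sum_(I : {set 'I_d} | I \subset S)
     (-1) ^+ inversions I (S :\: I) * (a I * b (S :\: I))].

Definition form0 f : dform F d :=
  [ffun I : {set 'I_d} => if I == finset.set0 then f else 0].

Definition dx (j : 'I_d) : dform F d :=
  [ffun I : {set 'I_d} => (I == [set j]%SET)%:R].

Definition fscale f w : dform F d := [ffun I => f * w I].

Definition partial_form (j : 'I_d) w : dform F d := [ffun I => (w I)^`M(j)].

Definition ext_d w : dform F d := \sum_(j < d) wedge (dx j) (partial_form j w).

Definition vol : dform F d := \big[wedge/form0 1]_(j < d) dx j.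

Fact wedge_linear a : linear (wedge a).
Proof.
move=> c u v; apply/ffunP=> S; rewrite !ffunE scaler_sumr -big_split /=.
apply: eq_bigr => I _; rewrite !ffunE.
by rewrite mulrDr mulrDr; congr (_ + _); rewrite -!scalerAr.
Qed.

HB.instance Definition _ a :=
  GRing.isLinear.Build F (dform F d) (dform F d) _ (wedge a) (wedge_linear a).

Fact ext_d_linear : linear ext_d.
Proof.
move=> c u v; rewrite /ext_d scaler_sumr -big_split /=.
apply: eq_bigr => j _; rewrite -linearP; congr (wedge _ _).
by apply/ffunP=> I; rewrite !ffunE linearP.
Qed.

HB.instance Definition _ :=
  GRing.isLinear.Build F (dform F d) (dform F d) _ ext_d ext_d_linear.

End Forms.
Arguments dx {F d} j.
Arguments vol {F d}.

Section Cohomology.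
Variables (F : comNzRingType) (d : nat).
Variables (D : {linear dform F d -> dform F d}) (p : int).

Definition cocycle_pred : {pred dform F d} :=
  fun w => is_form p w && (D w == 0).

Fact cocycle_submod_closed : submod_closed cocycle_pred.
Proof.
split=> [|c u v /andP[/forallP pu /eqP Du] /andP[/forallP pv /eqP Dv]].
  apply/andP; split; last by rewrite linear0.
  by apply/forallP=> I; rewrite ffunE eqxx.
apply/andP; split; last by rewrite linearP Du Dv scaler0 addr0.
apply/forallP=> I; apply/implyP; apply: contraNT => pI; rewrite !ffunE.
have /eqP-> : u I == 0 by apply: contraNT pI; apply/implyP.
have /eqP-> : v I == 0 by apply: contraNT pI; apply/implyP.
by rewrite scaler0 addr0.
Qed.

HB.instance Definition _ := GRing.isSubmodClosed.Build F (dform F d)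
  cocycle_pred cocycle_submod_closed.

Record cocycle := Cocycle {
  cocycle_val :> dform F d;
  _ : cocycle_val \in cocycle_pred }.

HB.instance Definition _ := [isSub for cocycle_val].
HB.instance Definition _ := [Choice of cocycle by <:].
HB.instance Definition _ := [SubChoice_isSubLmodule of cocycle by <:].

Definition coboundary : {pred cocycle} :=
  fun z => `[< exists2 w, is_form (p - 1) w & D w = val z >].

Fact coboundary_submod_closed : submod_closed coboundary.
Proof.
split=> [|c x y /asboolP[u pu Du] /asboolP[v pv Dv]]; apply/asboolP.
  exists 0; last by rewrite !linear0.
  by apply/forallP=> I; rewrite ffunE eqxx.
exists (c *: u + v); last by rewrite !linearP /= Du Dv.
move/forallP: pu => pu; move/forallP: pv => pv.
apply/forallP=> I; apply/implyP; apply: contraNT => pI; rewrite !ffunE.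
have /eqP-> : u I == 0 by apply: contraNT pI; apply/implyP.
have /eqP-> : v I == 0 by apply: contraNT pI; apply/implyP.
by rewrite scaler0 addr0.
Qed.

HB.instance Definition _ := GRing.isSubmodClosed.Build F cocycle
  coboundary coboundary_submod_closed.

Definition cohomology := lmod_quot coboundary.

HB.instance Definition _ := GRing.Lmodule.on cohomology.

Definition coh_class (z : cocycle) : cohomology := quot_class coboundary z.

End Cohomology.

(* [iota], [pi], [h] is a contraction of the complex of forms with differential
   [delta] onto the complex with [V] in degree [d] and 0 elsewhere. *)
Record contraction (F : comNzRingType) (d : nat) (V : lmodType F)
    (delta : dform F d -> dform F d) (iota : {linear V -> dform F d})
    (pi : {linear dform F d -> V}) (h : {linear dform F d -> dform F d}) : Prop := {
  iota_degree : forall v, is_form d (iota v);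
  pi_degree : forall (p : int) w, p != d -> is_form p w -> pi w = 0;
  h_degree : forall (p : int) w, is_form p w -> is_form (p - 1) (h w);
  iota_chain : forall v, delta (iota v) = 0;
  pi_chain : forall w, pi (delta w) = 0;
  contraction_homotopy : forall w, delta (h w) + h (delta w) = w - iota (pi w);
  pi_iota : forall v, pi (iota v) = v;
  h_h : forall w, h (h w) = 0;
  pi_h : forall w, pi (h w) = 0;
  h_iota : forall v, h (iota v) = 0 }.

Definition lowers_degree_by (F : comNzRingType) (d : nat) (r : int)
    (T : dform F d -> dform F d) : Prop :=
  forall k w, coef_homog k w -> coef_homog (k - r) (T w).

Section GeometricSeries.
Variables (V : zmodType) (T : V -> V).

Definition geom_term (k : nat) (v : V) : V := iter k (fun w => - T w) v.

Definition geom_finite : Prop :=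
  forall v, finite_set [set k | geom_term k v != 0]%classic.

(* The sum of (- T)^k over all k; a sum over an infinite support is 0 by
   convention, hence the role of [geom_finite]. *)
Definition geom_series (v : V) : V :=
  \sum_(k \in [set: nat]%classic) geom_term k v.

End GeometricSeries.

Section Twisted.
Variables (F : comNzRingType) (d : nat).

Definition twisted_d (f : {mpoly F[d]}) (w : dform F d) : dform F d :=
  ext_d w + wedge (ext_d (form0 f)) w.

Fact twisted_d_linear f : linear (twisted_d f).
Proof. by move=> c u v; rewrite /twisted_d !linearP scalerDr addrACA. Qed.

HB.instance Definition _ f := GRing.isLinear.Build F (dform F d) (dform F d)
  _ (twisted_d f) (twisted_d_linear f).

End Twisted.

Definition ratfun (R : realType) : Type := {fraction {poly R[i]}}.

HB.instance Definition _ (R : realType) := GRing.Field.on (ratfun R).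

Definition ratfun_const (R : realType) : R[i] -> ratfun R :=
  @tofrac {poly R[i]} \o @polyC R[i].

HB.instance Definition _ (R : realType) :=
  GRing.RMorphism.copy (@ratfun_const R) (@tofrac {poly R[i]} \o @polyC R[i]).

Section Operators.
Variables (R : realType) (d : nat).
Implicit Types (P Pm : {mpoly R[i][d]}).

Definition it : ratfun R := ratfun_const 'i%C * (tofrac 'X : ratfun R).

Definition mpolyK P : {mpoly (ratfun R)[d]} := map_mpoly (@ratfun_const R) P.

Definition quadratic : {mpoly (ratfun R)[d]} := \sum_(j < d) 'X_j ^+ 2.

Definition phase P : {mpoly (ratfun R)[d]} :=
  (- 2^-1) *: quadratic + it *: mpolyK P.

Definition nabla P : {linear dform (ratfun R) d -> dform (ratfun R) d} :=
  twisted_d (phase P).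

Definition delta0 Pm (w : dform (ratfun R) d) : dform (ratfun R) d :=
  wedge (it *: ext_d (form0 (mpolyK Pm))) w.

Definition eta_op P Pm (w : dform (ratfun R) d) : dform (ratfun R) d :=
  ext_d w - \sum_(j < d) wedge (fscale 'X_j (dx j)) w
    + wedge (it *: ext_d (form0 (mpolyK (P - Pm)))) w.

End Operators.

(* Main.v *)
Require Import Defs.
From HB Require Import structures.
From mathcomp Require Import all_boot all_order all_algebra.
From mathcomp Require Import finmap fraction complex ssrcomplements mpoly.
From mathcomp Require monalg.
Import (canonicals, coercions) monalg.
From mathcomp Require Import boolp classical_sets cardinality fsbigop reals ereal.
From mathcomp Require Import measure lebesgue_measure.
(* Unqualified set operations and their lemmas are those of finite sets. *)
From mathcomp Require Import finset.

Set Implicit Arguments.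
Unset Strict Implicit.
Unset Printing Implicit Defensive.

Import GRing.Theory.
Local Open Scope ring_scope.

(** Multiplication by [it], a unit of K = C(t), changes no ideal, so [delta0] is
the Koszul differential of the forms f_j = [it] d_j P_m, which are homogeneous of
degree r = m - 1.  Everything rests on two facts about such a system f.

Some power x_j^N of each coordinate lies in the ideal (f).  Over C this is the
homogeneous Nullstellensatz ([homog_nullstellensatz]), obtained here from the
uncountability of C: if 1 belonged to I + (x_j - c) for every c, the inverses of
the x_j - c modulo I would be uncountably many vectors in a space of countable
dimension, and a linear relation between them would give a nonzero polynomial in
x_j inside I ([adjoin_proper]).  The relation x_j^N = sum_k a_jk f_k is then
mapped to K.

The Koszul complex of f is exact below degree d ([koszul_exact]).  Contraction
with the coefficients a_j1, ..., a_jd is a homotopy between 0 and multiplication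
by x_j^N, and powers of distinct variables form a regular sequence, for which
exactness can be propagated one variable at a time ([koszul_exact_mod]).

Exactness expresses the rank of the Koszul operator on forms of bounded
polynomial degree through its rank one form degree lower.  All these ranks thus
depend on r, d and the bound only ([trank_unique]), so (f) has the same
codimension as the ideal of x_1^r, ..., x_d^r, which is r^d ([codim_ideal]).

For the contraction, bounded degrees give a linear generalized inverse g of
D = [delta0], that is D g D = D, which may be taken homogeneous for both degrees
([koszul_ginv_koszul]).  Then 1 - D g kills the image of D, 1 - g D projects onto
its kernel, and h = g D g (1 - g D), with iota sending a class to the image of a
representative under 1 - D g, satisfies all the identities of a contraction
([koszul_contraction]).

The operator h lowers polynomial degree by r while eta raises it by at most
r - 1, hence eta h is locally nilpotent.  With A = 1 + eta h, the identities
nabla^2 = 0 and eta iota = 0 (there is no form of degree d + 1) give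
nabla A = A delta, and the perturbed identities and the cohomology follow
formally ([perturbed_homotopy], [perturbed_pi], [top_cohomology]).

Finally the tensor product of the Jacobian quotient with K is the quotient of
K[x] by the Jacobian ideal over K: sending x^u to the class of x^u tensored with
1 is onto with this ideal as kernel ([extend_scalars_ker]). *)

(** * Exterior and interior multiplication by coordinate one-forms *)

Section OneForms.
Variables (F : comNzRingType) (d : nat).
Implicit Types (w a b : dform F d) (f g : {mpoly F[d]}) (S T : {set 'I_d}) (j k : 'I_d).

Lemma formNE w S : (- w) S = - w S.
Proof. by rewrite ffunE. Qed.

Lemma formDE w w' S : (w + w') S = w S + w' S.
Proof. by rewrite ffunE. Qed.

Lemma form0E S : (0 : dform F d) S = 0.
Proof. by rewrite ffunE. Qed.

Lemma formZE c w S : (c *: w) S = c *: w S.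
Proof. by rewrite ffunE. Qed.

(** The sign of dx_j /\ dx_S counts the transpositions that move j into
    place. *)
Definition below j S : nat := #|[set i in S | (i < j)%N]%SET|.

Lemma belowD1 j k S : below k S = (((j \in S) && (j < k)%N) + below k (S :\ j))%N.
Proof.
rewrite /below (cardsD1 j) inE; congr (_ + _)%N; apply: eq_card => i.
by rewrite !inE andbA.
Qed.

Lemma below_id j S : below j (S :\ j) = below j S.
Proof. by rewrite (belowD1 j j S) ltnn andbF. Qed.

Lemma belowU1 j k S : j \notin S -> below k (j |: S) = ((j < k)%N + below k S)%N.
Proof. by move=> jS; rewrite (belowD1 j) !inE eqxx /= setU1K. Qed.

Lemma inversions_set1 j S : inversions [set j]%SET S = below j S.
Proof.
rewrite /inversions /below -(card_imset (mem [set i in S | (i < j)%N]%SET) (f := pair j)).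
  apply: eq_card => -[i l]; rewrite !inE /=; apply/idP/imsetP.
    move=> /andP[/andP[/eqP-> lS] lj]; exists l => //; by rewrite !inE lS.
  by case=> l'; rewrite !inE => /andP[l'S lt] [-> ->]; rewrite eqxx l'S lt.
by move=> x y [].
Qed.

Lemma wedge_dxE j w S :
  wedge (dx j) w S = if j \in S then (-1) ^+ below j S * w (S :\ j) else 0.
Proof.
rewrite ffunE; case: ifPn => jS.
  rewrite (bigD1 [set j]%SET) ?sub1set //= big1 ?addr0.
    by rewrite ffunE eqxx mul1r inversions_set1 below_id.
  by move=> I /andP[_ /negPf nI]; rewrite ffunE nI mul0r mulr0.
rewrite big1 // => I IS; rewrite ffunE; case: eqP => [I1|_]; last by rewrite mul0r mulr0.
by move: IS; rewrite I1 sub1set (negPf jS).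
Qed.

(** Contraction with the vector field d/dx_j. *)
Definition interior j w : dform F d :=
  [ffun S : {set 'I_d} => if j \in S then 0 else (-1) ^+ below j S * w (j |: S)].

Lemma interiorE j w S :
  interior j w S = if j \in S then 0 else (-1) ^+ below j S * w (j |: S).
Proof. by rewrite ffunE. Qed.

Fact interior_linear j : linear (interior j).
Proof.
move=> c u v; apply/ffunP=> S; rewrite !ffunE; case: ifP => _; first by rewrite scaler0 addr0.
by rewrite mulrDr scalerAr.
Qed.

HB.instance Definition _ j := GRing.isLinear.Build F (dform F d) (dform F d) _
  (interior j) (interior_linear j).

Lemma fscaleE f w S : fscale f w S = f * w S.
Proof. by rewrite ffunE. Qed.

Fact fscale_linear f : linear (fscale f : dform F d -> dform F d).
Proof. by move=> c u v; apply/ffunP=> S; rewrite !ffunE mulrDr scalerAr. Qed.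

HB.instance Definition _ f := GRing.isLinear.Build F (dform F d) (dform F d) _
  (fscale f) (fscale_linear f).

Fact partial_form_linear j : linear (@partial_form F d j).
Proof. by move=> c u v; apply/ffunP=> S; rewrite !ffunE linearP. Qed.

HB.instance Definition _ j := GRing.isLinear.Build F (dform F d) (dform F d) _
  (@partial_form F d j) (partial_form_linear j).

(** Two ways of composing one-form operators differ by one transposition, that
    is, by an odd total exponent. *)
Lemma sign_swap (m1 m2 m3 m4 : nat) (x : {mpoly F[d]}) : odd (m1 + m2 + m3 + m4) ->
  (-1) ^+ m1 * ((-1) ^+ m2 * x) = - ((-1) ^+ m3 * ((-1) ^+ m4 * x)).
Proof.
move=> om; rewrite !mulrA -!exprD -mulNr -(mulN1r (_ ^+ (m3 + m4))) -exprS.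
rewrite -(signr_odd _ (m1 + m2)) -(signr_odd _ _.+1); congr (_ ^+ nat_of_bool _ * _).
by move: om; rewrite /= -addnA oddD; case: (odd (m1 + m2)); case: (odd _).
Qed.

Lemma wedge_dx_dx j w : wedge (dx j) (wedge (dx j) w) = 0.
Proof.
apply/ffunP=> S; rewrite [RHS]ffunE wedge_dxE; case: ifP => // jS.
by rewrite wedge_dxE !inE eqxx mulr0.
Qed.

Lemma ord_gtNlt j k : j != k -> (k < j)%N = ~~ (j < k)%N.
Proof. by rewrite eq_sym -leqNgt ltn_neqAle => kj; rewrite (kj : (k != j :> nat)). Qed.

Lemma wedge_dx_anti j k w : wedge (dx j) (wedge (dx k) w) = - wedge (dx k) (wedge (dx j) w).
Proof.
have [->|jk] := eqVneq j k; first by rewrite wedge_dx_dx oppr0.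
apply/ffunP=> S; rewrite formNE [LHS]wedge_dxE [in LHS]wedge_dxE [in RHS]wedge_dxE [in RHS]wedge_dxE.
case: (boolP (j \in S)) => jS; case: (boolP (k \in S)) => kS;
  rewrite ?inE ?jS ?kS ?jk ?(eq_sym k) ?jk ?(negPf jS) ?(negPf kS) ?andbF ?mulr0 ?oppr0 //=.
have -> : S :\ j :\ k = S :\ k :\ j by rewrite !setDDl setUC.
apply: sign_swap; rewrite (belowD1 k j S) (belowD1 j k S) jS kS /=.
rewrite (ord_gtNlt jk); case: (j < k)%N; rewrite /= !oddD /=; by do 2![case: (odd _)].
Qed.

(** The Clifford relation between contraction and exterior multiplication. *)
Lemma interior_wedge_dx j k w :
  interior j (wedge (dx k) w) + wedge (dx k) (interior j w) = if j == k then w else 0.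
Proof.
apply/ffunP=> S; rewrite formDE interiorE 2!wedge_dxE interiorE.
rewrite (fun_if (fun u : dform F d => u S)) form0E.
have [<-|jk] := eqVneq j k.
  rewrite !inE eqxx /=; case: (boolP (j \in S)) => jS.
    by rewrite add0r below_id setD1K // mulrA -exprD addnn -signr_odd odd_double mul1r.
  rewrite addr0 belowU1 // ltnn add0n setU1K //.
  by rewrite mulrA -exprD addnn -signr_odd odd_double mul1r.
rewrite !inE (eq_sym k) (negPf jk) /=.
case: (boolP (j \in S)) => jS; case: (boolP (k \in S)) => kS; rewrite ?mulr0 ?addr0 //=.
have -> : (j |: S) :\ k = j |: (S :\ k).
  by apply/setP=> i; rewrite !inE; case: (eqVneq i j) => [->|]; rewrite ?jk.
apply/eqP; rewrite addr_eq0; apply/eqP; apply: sign_swap.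
rewrite (belowD1 k j S) belowU1 // kS /=.
rewrite (ord_gtNlt jk); case: (j < k)%N; rewrite /= !oddD /=; by do 2![case: (odd _)].
Qed.

Lemma wedge_fscalel f a w : wedge (fscale f a) w = fscale f (wedge a w).
Proof.
apply/ffunP=> S; rewrite !ffunE mulr_sumr; apply: eq_bigr => I _; rewrite !ffunE.
by rewrite [RHS]mulrCA -mulrA.
Qed.

Lemma wedge_fscaler f a w : wedge a (fscale f w) = fscale f (wedge a w).
Proof.
apply/ffunP=> S; rewrite !ffunE mulr_sumr; apply: eq_bigr => I _; rewrite !ffunE.
by rewrite [RHS]mulrCA; congr (_ * _); rewrite mulrCA.
Qed.

Lemma wedgeDl w : {morph (fun a => wedge a w) : a b / a + b}.
Proof.
move=> a b; apply/ffunP=> S; rewrite !ffunE -big_split; apply: eq_bigr => I _ /=.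
by rewrite ffunE mulrDl mulrDr.
Qed.

Lemma wedge0l w : wedge 0 w = 0.
Proof. by apply/ffunP=> S; rewrite !ffunE big1 // => I _; rewrite ffunE mul0r mulr0. Qed.

Lemma wedge_suml (I : finType) (a : I -> dform F d) w :
  wedge (\sum_i a i) w = \sum_i wedge (a i) w.
Proof. by rewrite (big_morph _ (wedgeDl w) (wedge0l w)). Qed.

Lemma wedgeZl c a w : wedge (c *: a) w = c *: wedge a w.
Proof.
have sc (u : dform F d) : c *: u = fscale c%:MP u.
  by apply/ffunP=> S; rewrite !ffunE mul_mpolyC.
by rewrite !sc wedge_fscalel.
Qed.

Lemma interior_fscale j f w : interior j (fscale f w) = fscale f (interior j w).
Proof. by apply/ffunP=> S; rewrite !ffunE; case: ifP; rewrite ?mulr0 // mulrCA. Qed.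

Lemma fscaleA f g w : fscale f (fscale g w) = fscale (f * g) w.
Proof. by apply/ffunP=> S; rewrite !ffunE mulrA. Qed.

Lemma fscaleDl f g w : fscale (f + g) w = fscale f w + fscale g w.
Proof. by apply/ffunP=> S; rewrite !ffunE mulrDl. Qed.

Lemma fscale_suml (I : finType) (f : I -> {mpoly F[d]}) w :
  fscale (\sum_i f i) w = \sum_i fscale (f i) w.
Proof. by apply/ffunP=> S; rewrite sum_ffunE !ffunE mulr_suml; apply: eq_bigr=> i _; rewrite ffunE. Qed.

Lemma partial_wedge_dx j k w :
  partial_form j (wedge (dx k) w) = wedge (dx k) (partial_form j w).
Proof.
apply/ffunP=> S; rewrite ffunE !wedge_dxE; case: ifP => _; last by rewrite mderiv0.
rewrite ffunE; set s := (-1) ^+ _.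
have -> : s = ((-1) ^+ below k S)%:MP by rewrite /s rmorphXn rmorphN rmorph1.
by rewrite mderiv_mulC.
Qed.

Lemma partial_fscale j f w :
  partial_form j (fscale f w) = fscale f^`M(j) w + fscale f (partial_form j w).
Proof. by apply/ffunP=> S; rewrite !ffunE mderivM. Qed.

(** The cancellation behind D^2 = 0 for all the differentials below. The
    diagonal is a separate hypothesis so that the ring may have characteristic
    2. *)
Lemma sum_anti (V : zmodType) (A : 'I_d -> 'I_d -> V) :
  (forall j, A j j = 0) -> (forall j k, A j k = - A k j) -> \sum_j \sum_k A j k = 0.
Proof.
move=> Ad Aa.
have -> : \sum_j \sum_k A j k = \sum_(j < d) \sum_(k : 'I_d | (k < j)%N) A j k
    + \sum_(j < d) \sum_(k : 'I_d | (j < k)%N) A j k.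
  rewrite -big_split; apply: eq_bigr => j _ /=.
  rewrite (bigID (fun k : 'I_d => (k < j)%N)) /=; congr (_ + _).
  rewrite (bigD1 j) ?ltnn //= Ad add0r; apply: eq_bigl => k.
  by rewrite -leqNgt ltn_neqAle eq_sym andbC.
rewrite [X in _ + X](exchange_big_dep predT) //= -big_split big1 // => j _ /=.
by rewrite -big_split big1 // => k _; rewrite /= Aa addNr.
Qed.

End OneForms.

(** * The Koszul operator and the twisted differential *)

Section Koszul.
Variables (F : comNzRingType) (d : nat).
Implicit Types (w : dform F d) (f a : 'I_d -> {mpoly F[d]}).

Definition koszul f w : dform F d := \sum_k fscale (f k) (wedge (dx k) w).

Fact koszul_linear f : linear (koszul f).
Proof.
move=> c u v; rewrite /koszul scaler_sumr -big_split; apply: eq_bigr => k _ /=.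
by rewrite !linearP.
Qed.

HB.instance Definition _ f := GRing.isLinear.Build F (dform F d) (dform F d) _
  (koszul f) (koszul_linear f).

Definition koszul_homotopy a w : dform F d := \sum_j fscale (a j) (interior j w).

Lemma koszul_koszul f w : koszul f (koszul f w) = 0.
Proof.
rewrite /koszul.
under eq_bigr do rewrite !linear_sum /=.
apply: sum_anti => [j|j k]; rewrite !wedge_fscaler !fscaleA.
  by rewrite wedge_dx_dx linear0.
by rewrite wedge_dx_anti linearN /= mulrC.
Qed.

(** Summing the Clifford relation: contraction with a is a homotopy from 0 to
    multiplication by sum_j a_j f_j, so this element acts as 0 on the
    cohomology. *)
Lemma koszul_homotopyP f a w :
  koszul f (koszul_homotopy a w) + koszul_homotopy a (koszul f w) =
  fscale (\sum_j a j * f j) w.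
Proof.
rewrite /koszul /koszul_homotopy.
under eq_bigr do rewrite !linear_sum /=.
under [X in _ + X]eq_bigr do rewrite !linear_sum /=.
rewrite exchange_big -big_split fscale_suml; apply: eq_bigr => j _ /=.
rewrite -big_split /= (bigD1 j) //= big1 ?addr0.
  rewrite wedge_fscaler interior_fscale !fscaleA [f j * _]mulrC -linearD addrC.
  by rewrite interior_wedge_dx eqxx.
move=> k kj; rewrite wedge_fscaler interior_fscale !fscaleA [f k * _]mulrC -linearD addrC.
by rewrite interior_wedge_dx eq_sym (negPf kj) linear0.
Qed.

Lemma ext_d_form0 (g : {mpoly F[d]}) : ext_d (form0 g) = \sum_j fscale g^`M(j) (dx j).
Proof.
apply: eq_bigr => j _; apply/ffunP=> S; rewrite wedge_dxE !ffunE.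
have -> : (S == [set j]%SET) = (j \in S) && (S :\ j == set0).
  apply/eqP/andP => [->|[jS /eqP S0]]; first by rewrite inE setDv !eqxx.
  by rewrite -(setD1K jS) S0 setU0.
case: (boolP (j \in S)) => jS /=; last by rewrite mulr0.
case: eqP => [S0|_]; last by rewrite mulr0 mderiv0 mulr0.
by rewrite mulr1 -below_id S0 /below setIdE set0I cards0 mul1r.
Qed.

Lemma wedge_ext_d_form0 (g : {mpoly F[d]}) w :
  wedge (ext_d (form0 g)) w = koszul (fun j => g^`M(j)) w.
Proof. by rewrite ext_d_form0 wedge_suml; apply: eq_bigr=> j _; rewrite wedge_fscalel. Qed.

Lemma ext_d_ext_d w : ext_d (ext_d w) = 0.
Proof.
rewrite /ext_d.
under eq_bigr do rewrite !linear_sum /=.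
apply: sum_anti => [j|j k]; rewrite !partial_wedge_dx.
  by rewrite wedge_dx_dx.
rewrite wedge_dx_anti; congr (- wedge _ (wedge _ _)); apply/ffunP=> S.
by rewrite !ffunE mderiv_comm.
Qed.

(** The second derivatives of g are symmetric, hence drop out against the
    anticommuting one-forms. *)
Lemma ext_d_koszul (g : {mpoly F[d]}) w :
  ext_d (koszul (fun j => g^`M(j)) w) = - koszul (fun j => g^`M(j)) (ext_d w).
Proof.
apply/eqP; rewrite -addr_eq0 /ext_d /koszul.
under eq_bigr do rewrite !linear_sum /=.
under [X in _ + X]eq_bigr do rewrite !linear_sum /=.
rewrite [X in _ + X]exchange_big /= -big_split.
have E j k : wedge (dx j) (partial_form j (fscale g^`M(k) (wedge (dx k) w)))
    + fscale g^`M(k) (wedge (dx k) (wedge (dx j) (partial_form j w)))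
    = fscale g^`M(k)^`M(j) (wedge (dx j) (wedge (dx k) w)).
  rewrite partial_fscale linearD /= !wedge_fscaler partial_wedge_dx -addrA.
  by rewrite (wedge_dx_anti j k (partial_form j w)) linearN addNr addr0.
under eq_bigr do rewrite -big_split /=.
under eq_bigr do under eq_bigr do rewrite E.
rewrite sum_anti // => [j|j k]; first by rewrite wedge_dx_dx linear0.
by rewrite wedge_dx_anti linearN mderiv_comm.
Qed.

Lemma twisted_d_twisted_d (g : {mpoly F[d]}) w : twisted_d g (twisted_d g w) = 0.
Proof.
rewrite /twisted_d linearD /= [wedge _ (_ + _)]linearD /= ext_d_ext_d add0r.
rewrite !wedge_ext_d_form0 ext_d_koszul koszul_koszul addr0 addNr //.
Qed.

End Koszul.

(** * Form degree *)

Section FormDegree.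
Variables (F : comNzRingType) (d : nat).
Implicit Types (w : dform F d) (p : int) (S : {set 'I_d}).

Lemma is_formP p w : reflect (forall S, #|S|%:Z != p -> w S = 0) (is_form p w).
Proof.
apply: (iffP forallP) => [pw S pS|pw S].
  by apply/eqP; apply: contraNT pS; apply/implyP.
by apply/implyP; apply: contraNT => /pw->.
Qed.

Lemma is_form0 p : is_form p (0 : dform F d).
Proof. by apply/is_formP=> S _; rewrite form0E. Qed.

Lemma is_formD p w w' : is_form p w -> is_form p w' -> is_form p (w + w').
Proof.
move=> /is_formP pw /is_formP pw'; apply/is_formP=> S pS.
by rewrite formDE pw // pw' // addr0.
Qed.

Lemma is_formN p w : is_form p w -> is_form p (- w).
Proof. by move=> /is_formP pw; apply/is_formP=> S pS; rewrite formNE pw // oppr0. Qed.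

Lemma is_formB p w w' : is_form p w -> is_form p w' -> is_form p (w - w').
Proof. by move=> pw pw'; apply: is_formD => //; apply: is_formN. Qed.

Lemma is_form_sum p (I : Type) (r : seq I) (Q : pred I) (w : I -> dform F d) :
  (forall i, Q i -> is_form p (w i)) -> is_form p (\sum_(i <- r | Q i) w i).
Proof. by move=> pw; apply: (big_ind (is_form p)) => //; [exact: is_form0 | move=> *; exact: is_formD]. Qed.

Lemma is_form_fscale p f w : is_form p w -> is_form p (fscale f w).
Proof. by move=> /is_formP pw; apply/is_formP=> S pS; rewrite ffunE pw // mulr0. Qed.

Lemma is_formZ p c w : is_form p w -> is_form p (c *: w).
Proof. by move=> /is_formP pw; apply/is_formP=> S pS; rewrite formZE pw // scaler0. Qed.

Lemma is_form_wedge_dx p j w : is_form p w -> is_form (p + 1) (wedge (dx j) w).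
Proof.
move=> /is_formP pw; apply/is_formP=> S pS; rewrite wedge_dxE; case: ifP => // jS.
rewrite pw ?mulr0 //; apply: contra pS => /eqP <-.
by rewrite (cardsD1 j S) jS addnC PoszD.
Qed.

Lemma is_form_interior p j w : is_form p w -> is_form (p - 1) (interior j w).
Proof.
move=> /is_formP pw; apply/is_formP=> S pS; rewrite interiorE; case: ifPn => // jS.
rewrite pw ?mulr0 //; apply: contra pS => /eqP <-.
by rewrite cardsU1 jS addnC PoszD addrK.
Qed.

Lemma is_form_partial p j w : is_form p w -> is_form p (partial_form j w).
Proof. by move=> /is_formP pw; apply/is_formP=> S pS; rewrite ffunE pw // mderiv0. Qed.

Lemma is_form_koszul p f w : is_form p w -> is_form (p + 1) (koszul f w).
Proof. by move=> pw; apply: is_form_sum => j _; apply/is_form_fscale/is_form_wedge_dx. Qed.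

Lemma is_form_ext_d p w : is_form p w -> is_form (p + 1) (ext_d w).
Proof. by move=> pw; apply: is_form_sum => j _; apply/is_form_wedge_dx/is_form_partial. Qed.

Lemma is_form_koszul_homotopy p a w : is_form p w -> is_form (p - 1) (koszul_homotopy a w).
Proof. by move=> pw; apply: is_form_sum => j _; apply/is_form_fscale/is_form_interior. Qed.

Lemma is_form_eq0 p w : is_form p w -> ~~ (0 <= p <= d%:Z) -> w = 0.
Proof.
move=> /is_formP pw pd; apply/ffunP=> S; rewrite form0E pw //.
apply: contra pd => /eqP <-; rewrite lez_nat /=.
by rewrite -[X in (_ <= X)%N]card_ord max_card.
Qed.

Definition form_part p w : dform F d := [ffun S : {set 'I_d} => if #|S|%:Z == p then w S else 0].

Lemma form_partE p w S : form_part p w S = if #|S|%:Z == p then w S else 0.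
Proof. by rewrite ffunE. Qed.

Fact form_part_linear p : linear (form_part p).
Proof.
move=> c u v; apply/ffunP=> S; rewrite formDE formZE 3!form_partE formDE formZE.
by case: eqP; rewrite ?scaler0 ?addr0.
Qed.

HB.instance Definition _ p := GRing.isLinear.Build F (dform F d) (dform F d) _
  (form_part p) (form_part_linear p).

Lemma is_form_part p w : is_form p (form_part p w).
Proof. by apply/is_formP=> S; rewrite ffunE => /negPf->. Qed.

Lemma form_part_id p w : is_form p w -> form_part p w = w.
Proof. by move=> /is_formP pw; apply/ffunP=> S; rewrite ffunE; case: eqP => // /eqP /pw->. Qed.

(** The degrees 0, ..., d exhaust all index sets. *)
Lemma form_part_sum w : w = \sum_(p < d.+1) form_part p%:Z w.
Proof.
apply/ffunP=> S; rewrite sum_ffunE.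
have ltS : (#|S| < d.+1)%N by rewrite ltnS -[X in (_ <= X)%N]card_ord max_card.
rewrite (bigD1 (Ordinal ltS)) //= big1 => [|q]; rewrite ffunE ?eqxx ?addr0 //.
by move=> /negPf qS; rewrite eqz_nat eq_sym (qS : (q == #|S| :> nat) = false).
Qed.

Lemma form_part_koszul p f w :
  form_part (p + 1) (koszul f w) = koszul f (form_part p w).
Proof.
rewrite {1}[w]form_part_sum (linear_sum (koszul f)) (linear_sum (form_part (p + 1))) /=.
have pf q v : is_form q v -> form_part (p + 1) (koszul f v) = koszul f (form_part p v).
  move=> qv; have [<-|qp] := eqVneq q p.
    by rewrite !form_part_id //; apply: is_form_koszul.
  have kv := is_form_koszul f qv.
  suff [-> ->] : form_part p v = 0 /\ form_part (p + 1) (koszul f v) = 0 by rewrite linear0.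
  split; apply/ffunP=> S; rewrite ffunE form0E; case: eqP => // eS.
    by apply: (is_formP _ _ qv); rewrite eS eq_sym.
  by apply: (is_formP _ _ kv); rewrite eS (inj_eq (addIr _)) eq_sym.
under eq_bigr do rewrite (pf _ _ (is_form_part _ _)).
by rewrite -(linear_sum (koszul f)) -(linear_sum (form_part p)) -form_part_sum.
Qed.

End FormDegree.

Lemma mcoeffM_eq0 (F : comNzRingType) (d : nat) (p q : {mpoly F[d]}) (u : 'X_{1..d}) :
  (forall u1 u2 : 'X_{1..d}, u = (u1 + u2)%MM -> p@_u1 * q@_u2 = 0) -> (p * q)@_u = 0.
Proof. by move=> E; rewrite mcoeffM big1 // => -[u1 u2] /= /eqP; apply: E. Qed.

(** * Exactness of the Koszul complex *)

Section MonomialIdeal.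
Variables (F : comNzRingType) (d N : nat).
Implicit Types (p q : {mpoly F[d]}) (w : dform F d) (k : nat) (j : 'I_d).

(** The ideal generated by x_i^N for i < k: it is spanned by monomials, so
    membership can be read off the coefficients of the monomials outside
    it. *)
Definition pow_ideal k p : Prop :=
  forall u : 'X_{1..d}, (forall i : 'I_d, (i < k)%N -> (u i < N)%N) -> p@_u = 0.

Lemma pow_ideal0 k : pow_ideal k 0.
Proof. by move=> u _; rewrite mcoeff0. Qed.

Lemma pow_idealD k p q : pow_ideal k p -> pow_ideal k q -> pow_ideal k (p + q).
Proof. by move=> Ip Iq u uk; rewrite mcoeffD Ip // Iq // addr0. Qed.

Lemma pow_idealM k p q : pow_ideal k q -> pow_ideal k (p * q).
Proof.
move=> Iq u uk; apply: mcoeffM_eq0 => u1 u2 eu; rewrite [X in _ * X]Iq ?mulr0 // => i /uk.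
by apply: leq_ltn_trans; rewrite eu mnmDE leq_addl.
Qed.

Lemma pow_idealN k p : pow_ideal k p -> pow_ideal k (- p).
Proof. by move=> Ip; rewrite -mulN1r; apply: pow_idealM. Qed.

Lemma pow_ideal_sum k (I : Type) (r : seq I) (Q : pred I) (p : I -> {mpoly F[d]}) :
  (forall i, Q i -> pow_ideal k (p i)) -> pow_ideal k (\sum_(i <- r | Q i) p i).
Proof. by move=> pw; apply: (big_ind (pow_ideal k)) => //; [exact: pow_ideal0 | move=> *; exact: pow_idealD]. Qed.

Lemma pow_idealS k p : pow_ideal k p -> pow_ideal k.+1 p.
Proof. by move=> Ip u uk; apply: Ip => i ik; apply: uk; apply: ltnW. Qed.

Lemma pow_idealX j p : pow_ideal j.+1 ('X_j ^+ N * p).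
Proof.
move=> u uk; apply: mcoeffM_eq0 => u1 u2 eu.
rewrite mcoeffXn; case: eqP => [e1|]; last by rewrite mul0r.
by have := uk j (ltnSn _); rewrite eu -e1 mnmDE mulmnE mnm1E eqxx mul1n ltnNge leq_addr.
Qed.

(** x_j^N is a nonzerodivisor modulo the N-th powers of the earlier variables,
    because multiplying a monomial by x_j^N does not change its other
    exponents. *)
Lemma pow_ideal_reg j p : pow_ideal j ('X_j ^+ N * p) -> pow_ideal j p.
Proof.
move=> Ip u uj; have := Ip (U_(j) *+ N + u)%MM.
rewrite mulrC mpolyXn mcoeffMX; apply => i ij; rewrite mnmDE mulmnE mnm1E.
by rewrite eq_sym (negPf (_ : i != j)) ?uj // -(inj_eq val_inj) neq_ltn ij.
Qed.

Definition divXn j p : {mpoly F[d]} :=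
  \sum_(u <- msupp p | (N <= u j)%N) p@_u *: 'X_[u - (U_(j) *+ N)].

Lemma divXnP j p : pow_ideal j.+1 p -> pow_ideal j (p - 'X_j ^+ N * divXn j p).
Proof.
move=> Ip u uj.
have -> : p - 'X_j ^+ N * divXn j p = \sum_(u <- msupp p | (u j < N)%N) p@_u *: 'X_[u].
  rewrite {1}[p]mpolyE (bigID (fun u : 'X_{1..d} => (u j < N)%N)) /= -addrA.
  rewrite -[RHS]addr0; congr (_ + _); apply/eqP; rewrite subr_eq0 mulr_sumr.
  apply/eqP; under eq_bigl do rewrite -leqNgt; apply: eq_bigr => v Nv.
  rewrite -scalerAr mpolyXn -mpolyXD addmC submK //.
  apply/mnm_lepP=> i; rewrite mulmnE mnm1E; case: eqP => [<-|_] //.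
  by rewrite mul1n.
rewrite raddf_sum big1_seq //= => v /andP[vN vp].
rewrite mcoeffZ mcoeffX; case: eqP => [evu|]; last by rewrite mulr0.
rewrite evu Ip ?mul0r // => i; rewrite ltnS leq_eqVlt => /orP[|/uj//].
by rewrite (inj_eq val_inj) => /eqP->; rewrite -evu.
Qed.

Lemma divXn0 j : divXn j 0 = 0.
Proof. by rewrite /divXn msupp0 big_nil. Qed.

End MonomialIdeal.

Section KoszulExact.
Variables (F : comNzRingType) (d N : nat) (f : 'I_d -> {mpoly F[d]}).
Variable a : 'I_d -> 'I_d -> {mpoly F[d]}.
Hypothesis Xn_in : forall j, 'X_j ^+ N = \sum_k a j k * f k.
Implicit Types (w : dform F d).

Let E k w := forall S, pow_ideal N k (w S).

Let ED k w w' : E k w -> E k w' -> E k (w + w').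
Proof. by move=> Ew Ew' S; rewrite formDE; apply: pow_idealD. Qed.

Let E_sum k (I : finType) (w : I -> dform F d) : (forall i, E k (w i)) -> E k (\sum_i w i).
Proof. by move=> Ew S; rewrite sum_ffunE; apply: pow_ideal_sum => i _; exact: Ew. Qed.

Let E_koszul k w : E k w -> E k (koszul f w).
Proof.
move=> Ew; apply: E_sum => i S; rewrite ffunE; apply: pow_idealM; rewrite wedge_dxE.
by case: ifP => _; [apply: pow_idealM; exact: Ew | exact: pow_ideal0].
Qed.

Let E_homotopy k b w : E k w -> E k (koszul_homotopy b w).
Proof.
move=> Ew; apply: E_sum => i S; rewrite ffunE; apply: pow_idealM; rewrite interiorE.
by case: ifP => _; [exact: pow_ideal0 | apply: pow_idealM; exact: Ew].
Qed.

(** Exactness modulo the first k powers, in form degrees below d - k, by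
    induction on the form degree. Write H for contraction with the
    coefficients of x_k^N. If D w vanishes modulo the first k powers, then
    x_k^N w = D H w modulo them, so H w is closed modulo k + 1 powers and of
    lower degree; by induction H w = D u + x_k^N v, whence x_k^N w = x_k^N D
    v, and x_k^N can be cancelled. *)
Lemma koszul_exact_mod (i k : nat) w : (i + k < d)%N -> is_form i%:Z w ->
  E k (koszul f w) -> exists2 u, is_form (i%:Z - 1) u & E k (w - koszul f u).
Proof.
elim: i k w => [|i IHi] k w ltd iw Edw;
  have ltk : (k < d)%N := leq_ltn_trans (leq_addl _ _) ltd;
  have := koszul_homotopyP f (a (Ordinal ltk)) w; rewrite -Xn_in;
  set j := Ordinal ltk; set Hw := koszul_homotopy (a j) w => XNw.
  exists 0; first exact: is_form0.
  have Hw0 : Hw = 0 by apply: (is_form_eq0 (is_form_koszul_homotopy _ iw)).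
  move: XNw; rewrite Hw0 linear0 add0r subr0 => XNw S.
  apply: (pow_ideal_reg (j := j)); have := E_homotopy (a j) Edw.
  by rewrite XNw => /(_ S); rewrite ffunE.
have iHw : is_form i%:Z Hw.
  by have := is_form_koszul_homotopy (a j) iw; rewrite -addn1 PoszD addrK.
have Eh : E k (koszul_homotopy (a j) (koszul f w)) by apply: E_homotopy.
have [||u iu Eu] := IHi k.+1 Hw _ iHw.
- by rewrite addnS.
- move=> S; have -> : koszul f Hw = fscale ('X_j ^+ N) w - koszul_homotopy (a j) (koszul f w).
    by rewrite -XNw addrK.
  rewrite formDE formNE fscaleE; apply: pow_idealD; first exact: (@pow_idealX _ _ N j).
  by apply/pow_idealN/pow_idealS; apply: Eh.
pose v : dform F d := [ffun S => divXn N j ((Hw - koszul f u) S)].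
have iv : is_form i%:Z v.
  have : is_form i%:Z (Hw - koszul f u).
    by apply: is_formB => //; have := is_form_koszul f iu; rewrite subrK.
  by move=> /is_formP iH; apply/is_formP=> S /iH H0; rewrite ffunE H0 divXn0.
exists v; first by rewrite -addn1 PoszD addrK.
move=> S; apply: (pow_ideal_reg (j := j)).
have Ev : E k (Hw - koszul f u - fscale ('X_j ^+ N) v).
  by move=> T; rewrite formDE formNE fscaleE [v T]ffunE; apply: (divXnP (j := j)); apply: Eu.
have := ED Eh (E_koszul Ev); move=> /(_ S).
rewrite !(linearB (koszul f)) /= koszul_koszul subr0.
have -> : koszul f (fscale ('X_j ^+ N) v) = fscale ('X_j ^+ N) (koszul f v).
  rewrite /koszul linear_sum; apply: eq_bigr => l _ /=.
  by rewrite wedge_fscaler !fscaleA mulrC.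
by rewrite addrA [koszul_homotopy _ _ + _]addrC XNw -linearB fscaleE.
Qed.

Lemma koszul_exact (i : nat) w : (i < d)%N -> is_form i%:Z w -> koszul f w = 0 ->
  exists2 u, is_form (i%:Z - 1) u & w = koszul f u.
Proof.
move=> id iw dw0; have [|S|u iu E0] := @koszul_exact_mod i 0 w _ iw.
- by rewrite addn0.
- by rewrite dw0 form0E; apply: pow_ideal0.
exists u => //; apply/eqP; rewrite -subr_eq0; apply/eqP/ffunP=> S.
by apply/mpolyP=> m; rewrite E0 // form0E mcoeff0.
Qed.

End KoszulExact.

(** * Polynomial degree of the coefficients *)

Section DegreeFilter.
Variables (F : comNzRingType) (d : nat).
Implicit Types (p q : {mpoly F[d]}) (w : dform F d) (P Q : pred nat).

Definition mfilter P p : {mpoly F[d]} := \sum_(u <- msupp p | P (mdeg u)) p@_u *: 'X_[u].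

Lemma mcoeff_filter P p u : (mfilter P p)@_u = if P (mdeg u) then p@_u else 0.
Proof.
rewrite raddf_sum /=; case: ifP => Pu; last first.
  rewrite big1 // => v Pv; rewrite mcoeffZ mcoeffX; case: eqP => [e|]; last by rewrite mulr0.
  by rewrite e Pu in Pv.
have [pu|pu] := boolP (u \in msupp p).
  rewrite big_mkcond (bigD1_seq u) ?msupp_uniq //= Pu mcoeffZ mcoeffX eqxx mulr1 big1 ?addr0 // => v /negPf vu.
  by rewrite mcoeffZ mcoeffX vu mulr0 if_same.
rewrite (memN_msupp_eq0 pu) big1_seq // => v /andP[_ vp]; rewrite mcoeffZ mcoeffX.
case: eqP => [e|_]; last by rewrite mulr0.
by rewrite -e vp in pu.
Qed.

(** A homogeneous factor of degree r shifts the degree filter by r. *)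
Lemma mfilterM P Q r p q : p \is r.-homog -> (forall k, Q (k + r)%N = P k) ->
  mfilter Q (p * q) = p * mfilter P q.
Proof.
move=> hp QP; apply/mpolyP=> u; rewrite mcoeff_filter !mcoeffM.
have E (u1 u2 : 'X_{1..d}) : u == (u1 + u2)%MM ->
    p@_u1 * (mfilter P q)@_u2 = if Q (mdeg u) then p@_u1 * q@_u2 else 0.
  move=> /eqP eu; rewrite mcoeff_filter.
  have [du1|du1] := eqVneq (mdeg u1) r; last first.
    by rewrite (dhomog_nemf_coeff hp du1) !mul0r if_same.
  rewrite eu mdegD du1 addnC.
  by rewrite QP; case: ifP; rewrite ?mulr0.
under [RHS]eq_bigr => k ek do rewrite (E _ _ ek).
by case: ifP => // _; rewrite big1.
Qed.

Definition form_filter P w : dform F d := [ffun S : {set 'I_d} => mfilter P (w S)].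

Lemma form_filterE P w S : form_filter P w S = mfilter P (w S).
Proof. by rewrite ffunE. Qed.

Fact mfilter_linear P : linear (mfilter P).
Proof.
move=> c p q; apply/mpolyP=> u; rewrite mcoeffD mcoeffZ !mcoeff_filter mcoeffD mcoeffZ.
by case: ifP; rewrite ?mulr0 ?addr0.
Qed.

HB.instance Definition _ P := GRing.isLinear.Build F {mpoly F[d]} {mpoly F[d]} _
  (mfilter P) (mfilter_linear P).

Fact form_filter_linear P : linear (form_filter P).
Proof.
by move=> c u v; apply/ffunP=> S; rewrite formDE formZE !form_filterE formDE formZE linearP.
Qed.

HB.instance Definition _ P := GRing.isLinear.Build F (dform F d) (dform F d) _
  (form_filter P) (form_filter_linear P).

Lemma form_filter_comp P Q w : form_filter P (form_filter Q w) = form_filter (predI P Q) w.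
Proof.
apply/ffunP=> S; rewrite !form_filterE; apply/mpolyP=> u; rewrite !mcoeff_filter /=.
by case: (P _); case: (Q _).
Qed.

Lemma eq_form_filter P Q w : P =1 Q -> form_filter P w = form_filter Q w.
Proof.
by move=> PQ; apply/ffunP=> S; rewrite !form_filterE; apply/mpolyP=> u; rewrite !mcoeff_filter PQ.
Qed.

Lemma is_form_filter (p : int) P w : is_form p w -> is_form p (form_filter P w).
Proof.
by move=> /is_formP pw; apply/is_formP=> S pS; rewrite form_filterE pw // linear0.
Qed.

Lemma form_filter_koszul P Q r (f : 'I_d -> {mpoly F[d]}) w :
  (forall j, f j \is r.-homog) -> (forall k, Q (k + r)%N = P k) ->
  form_filter Q (koszul f w) = koszul f (form_filter P w).
Proof.
move=> hf QP; rewrite (linear_sum (form_filter Q)); apply: eq_bigr => j _.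
apply/ffunP=> S; rewrite form_filterE 2!fscaleE (mfilterM _ (hf j) QP) 2!wedge_dxE; congr (_ * _).
case: ifP => _; last by rewrite linear0.
have -> : (-1) ^+ below j S = ((-1) ^+ below j S)%:MP :> {mpoly F[d]}.
  by rewrite rmorphXn rmorphN rmorph1.
by rewrite !mul_mpolyC linearZ form_filterE.
Qed.

Definition deg_lt n w := form_filter (fun k => (k < n)%N) w = w.

Lemma deg_ltP n w : deg_lt n w <-> (forall S u, (n <= mdeg u)%N -> (w S)@_u = 0).
Proof.
split=> [<- S u nu|wn]; first by rewrite form_filterE mcoeff_filter ltnNge nu.
apply/ffunP=> S; rewrite form_filterE; apply/mpolyP=> u; rewrite mcoeff_filter.
by case: ltnP => // /wn ->.
Qed.

Lemma deg_lt_le n k w : (n <= k)%N -> deg_lt n w -> deg_lt k w.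
Proof. by move=> nk /deg_ltP wn; apply/deg_ltP=> S u ku; apply/wn/(leq_trans nk). Qed.

Lemma deg_lt_filter n w : deg_lt n (form_filter (fun k => (k < n)%N) w).
Proof. by rewrite /deg_lt form_filter_comp; apply: eq_form_filter => k /=; rewrite andbb. Qed.

Lemma deg_lt0 w : deg_lt 0 w -> w = 0.
Proof. by move=> /deg_ltP w0; apply/ffunP=> S; apply/mpolyP=> u; rewrite w0 // form0E mcoeff0. Qed.

Lemma deg_lt_exists w : exists n, deg_lt n w.
Proof.
exists (\max_(S : {set 'I_d}) msize (w S)); apply/deg_ltP=> S u Su.
by apply/memN_msupp_eq0/msize_mdeg_ge/(leq_trans _ Su)/(leq_bigmax S).
Qed.

(** The truncated subtraction is harmless: if n < r, no term of the Koszul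
    operator has degree below n. *)
Lemma filter_koszul_lt r n (f : 'I_d -> {mpoly F[d]}) w : (forall j, f j \is r.-homog) ->
  form_filter (fun k => (k < n)%N) (koszul f w) =
  koszul f (form_filter (fun k => (k < n - r)%N) w).
Proof. by move=> hf; apply: (form_filter_koszul _ hf) => k; rewrite addnC ltn_subRL. Qed.

Lemma deg_lt_koszul r n (f : 'I_d -> {mpoly F[d]}) w : (forall j, f j \is r.-homog) ->
  deg_lt (n - r) w -> deg_lt n (koszul f w).
Proof. by move=> hf wn; rewrite /deg_lt (filter_koszul_lt _ _ hf) wn. Qed.

End DegreeFilter.

(** * Ranks of the Koszul operator in bounded degree *)

Section Truncation.
Variables (F : fieldType) (d B : nat).
Implicit Types (w : dform F d).

Local Notation tindex := ({set 'I_d} * 'X_{1..d < B})%type.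
Local Notation tform := {ffun tindex -> F^o}.

(** Forms with coefficients of degree < B, as a finite-dimensional space;
    [treal] embeds it back. *)
Definition tcoord w : tform := [ffun x : tindex => (w x.1)@_(x.2)].

Definition treal (v : tform) : dform F d :=
  [ffun S : {set 'I_d} => \sum_(u : 'X_{1..d < B}) (v (S, u) : F) *: 'X_[u]].

Fact tcoord_linear : linear tcoord.
Proof. by move=> c u v; apply/ffunP=> x; rewrite !ffunE mcoeffD mcoeffZ. Qed.

HB.instance Definition _ := GRing.isLinear.Build F (dform F d) tform _ tcoord tcoord_linear.

Fact treal_linear : linear treal.
Proof.
move=> c u v; apply/ffunP=> S; rewrite !ffunE scaler_sumr -big_split; apply: eq_bigr => m _ /=.
by rewrite !ffunE scalerDl scalerA.
Qed.

HB.instance Definition _ := GRing.isLinear.Build F tform (dform F d) _ treal treal_linear.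

Lemma mcoeff_treal v S (u : 'X_{1..d}) (ltu : (mdeg u < B)%N) :
  (treal v S)@_u = v (S, BMultinom ltu).
Proof.
rewrite ffunE raddf_sum (bigD1 (BMultinom ltu)) //= mcoeffZ mcoeffX eqxx mulr1.
by rewrite big1 ?addr0 // => m /negPf nm; rewrite mcoeffZ mcoeffX (_ : (_ == u) = false) ?mulr0.
Qed.

Lemma deg_lt_treal v : deg_lt B (treal v).
Proof.
apply/deg_ltP=> S u Bu; rewrite ffunE raddf_sum big1 //= => m _.
rewrite mcoeffZ mcoeffX; case: eqP => [e|]; last by rewrite mulr0.
by have := bmdeg m; rewrite e ltnNge Bu.
Qed.

Lemma trealK : cancel treal tcoord.
Proof.
move=> v; apply/ffunP=> -[S [u ltu]]; rewrite ffunE /= mcoeff_treal.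
by congr (v (_, _)); apply: val_inj.
Qed.

Lemma tcoordK w : treal (tcoord w) = form_filter (fun k => (k < B)%N) w.
Proof.
apply/ffunP=> S; rewrite form_filterE; apply/mpolyP=> u; rewrite mcoeff_filter.
case: ltnP => Bu; first by rewrite mcoeff_treal ffunE.
by move/deg_ltP: (deg_lt_treal (tcoord w)) => ->.
Qed.

Lemma tcoord_deg_lt w : deg_lt B w -> treal (tcoord w) = w.
Proof. by rewrite tcoordK. Qed.

Definition tpart (q n : nat) (x : tindex) :=
  (#|x.1|.+1 == q) && (mdeg x.2 < n)%N.

Definition tcut q n (v : tform) : tform := [ffun x => if tpart q n x then 0 else v x].

Fact tcut_linear q n : linear (tcut q n).
Proof.
by move=> c u v; apply/ffunP=> x; rewrite !ffunE; case: ifP; rewrite ?scaler0 ?addr0.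
Qed.

HB.instance Definition _ q n := GRing.isLinear.Build F tform tform _ (tcut q n) (tcut_linear q n).

(** The shift of the form degree by one makes the index q = 0 stand for degree
    -1, where the induction on ranks starts. *)
Definition tspace q n : {vspace tform} := lker (linfun (tcut q n)).

Lemma tspaceP q n v : reflect (is_form (q%:Z - 1) (treal v) /\ deg_lt n (treal v)) (v \in tspace q n).
Proof.
rewrite memv_ker lfunE; apply: (iffP eqP) => [v0|[/is_formP qv /deg_ltP vn]].
  have E S (u : 'X_{1..d}) (ltu : (mdeg u < B)%N) : ~~ tpart q n (S, BMultinom ltu) ->
      v (S, BMultinom ltu) = 0.
    by move=> /negPf qn; move/ffunP/(_ (S, BMultinom ltu)): v0; rewrite !ffunE qn.
  split.
    apply/is_formP=> S qS; apply/mpolyP=> u; rewrite mcoeff0.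
    have [ltu|Bu] := ltnP (mdeg u) B; last by move/deg_ltP: (deg_lt_treal v) => ->.
    rewrite mcoeff_treal E // /tpart /=; apply: contra qS => /andP[/eqP <- _].
    by rewrite -addn1 PoszD addrK.
  apply/deg_ltP=> S u nu.
  have [ltu|Bu] := ltnP (mdeg u) B; last by move/deg_ltP: (deg_lt_treal v) => ->.
  by rewrite mcoeff_treal E // /tpart /= ltnNge nu andbF.
apply/ffunP=> -[S [u ltu]]; rewrite !ffunE; case: ifPn => //; rewrite /tpart /=.
rewrite negb_and -leqNgt => /orP qn; rewrite -mcoeff_treal.
case: qn => [Sq|nu]; last exact: vn.
rewrite qv ?mcoeff0 //; apply: contra Sq.
by rewrite -(inj_eq (addIr 1)) subrK -PoszD addn1 eqz_nat.
Qed.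

Lemma tcoord_tspace q n w : (n <= B)%N -> is_form (q%:Z - 1) w -> deg_lt n w ->
  tcoord w \in tspace q n.
Proof.
move=> nB qw wn; apply/tspaceP.
by rewrite tcoord_deg_lt //; apply: deg_lt_le wn.
Qed.

Definition tkoszul (f : 'I_d -> {mpoly F[d]}) : 'End(tform) :=
  linfun (tcoord \o koszul f \o treal).

Lemma tkoszulE f v : tkoszul f v = tcoord (koszul f (treal v)).
Proof. by rewrite lfunE. Qed.

Variables (r N : nat) (f : 'I_d -> {mpoly F[d]}) (a : 'I_d -> 'I_d -> {mpoly F[d]}).
Hypothesis homog_f : forall j, f j \is r.-homog.
Hypothesis Xn_in : forall j, 'X_j ^+ N = \sum_k a j k * f k.

Lemma treal_tkoszul n v : (n <= B)%N -> deg_lt (n - r) (treal v) ->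
  treal (tkoszul f v) = koszul f (treal v).
Proof.
move=> nB vn; rewrite tkoszulE tcoord_deg_lt //.
by apply: (deg_lt_le nB); apply: deg_lt_koszul vn.
Qed.

(** A primitive of a form of degree < n can be truncated to degree < n - r,
    because the Koszul operator is homogeneous; so exactness persists in
    bounded degree. *)
Lemma tker_exact q n : (q < d)%N -> (n + r <= B)%N ->
  (tspace q.+1 n :&: lker (tkoszul f))%VS = (tkoszul f @: tspace q (n - r))%VS.
Proof.
move=> qd nrB; have nB : (n <= B)%N := leq_trans (leq_addr _ _) nrB.
apply/eqP; rewrite eqEsubv; apply/andP; split; apply/subvP=> v.
  rewrite memv_cap => /andP[/tspaceP[qv vn]]; rewrite memv_ker => /eqP kv.
  have {}qv : is_form q%:Z (treal v) by move: qv; rewrite -addn1 PoszD addrK.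
  have kv0 : koszul f (treal v) = 0.
    by rewrite -(@treal_tkoszul (n + r)) ?addnK // kv linear0.
  have [u qu vu] := koszul_exact Xn_in qd qv kv0.
  pose u' := form_filter (fun k => (k < n - r)%N) u.
  have u'n : deg_lt (n - r) u' by apply: deg_lt_filter.
  have u'r : treal (tcoord u') = u'.
    by apply: tcoord_deg_lt; apply: deg_lt_le u'n; rewrite (leq_trans (leq_subr _ _)).
  have ku' : koszul f u' = treal v by rewrite -(filter_koszul_lt _ _ homog_f) -vu vn.
  have -> : v = tkoszul f (tcoord u') by rewrite tkoszulE u'r ku' trealK.
  by apply/memv_img/tcoord_tspace => //; [rewrite (leq_trans (leq_subr _ _)) | apply: is_form_filter].
move=> /memv_imgP[y /tspaceP[qy yn] ->]; have ky := treal_tkoszul nB yn.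
rewrite memv_cap; apply/andP; split.
  apply/tspaceP; rewrite ky; split; last exact: deg_lt_koszul yn.
  by rewrite -addn1 PoszD addrK -[q%:Z](subrK 1); apply: is_form_koszul.
by rewrite memv_ker tkoszulE ky koszul_koszul linear0.
Qed.

End Truncation.

(** The rank is the dimension of the whole space minus that of the kernel, and
    by exactness the kernel is the image of the preceding degree. Induction on
    the form degree then determines all ranks from dimensions that do not
    involve the system. *)
Lemma trank_unique (F : fieldType) (d B r N : nat) (f g : 'I_d -> {mpoly F[d]}) a b q n :
  (forall j, f j \is r.-homog) -> (forall j, g j \is r.-homog) ->
  (forall j, 'X_j ^+ N = \sum_k a j k * f k) ->
  (forall j, 'X_j ^+ N = \sum_k b j k * g k) ->
  (q <= d)%N -> (n + r <= B)%N ->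
  \dim (tkoszul B f @: tspace F d B q n) = \dim (tkoszul B g @: tspace F d B q n).
Proof.
move=> hf hg fX gX; elim: q n => [|q IHq] n qd nB.
  suff -> : tspace F d B 0 n = 0%VS by rewrite !limg0.
  apply/eqP; rewrite -subv0; apply/subvP=> v /tspaceP[vf _].
  rewrite memv0 -[v]trealK; apply/eqP; rewrite (is_form_eq0 vf) ?linear0 //.
have := limg_ker_dim (tkoszul B f) (tspace F d B q.+1 n).
have := limg_ker_dim (tkoszul B g) (tspace F d B q.+1 n).
rewrite (tker_exact hf fX) // (tker_exact hg gX) // => <-.
rewrite IHq; [exact: addnI | exact: ltnW |].
have [rn|nr] := leqP r n; first by rewrite subnK // (leq_trans (leq_addr _ _) nB).
by rewrite (eqP (ltnW nr : (n - r == 0)%N)) add0n (leq_trans (leq_addl _ _) nB).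
Qed.

(** * Isomorphisms of quotients and codimension *)

Section LinearIsos.
Variables (F : nzRingType) (V : lmodType F).

(** Two quotients by the same kernel: transport a preimage under phi through
    psi. *)
Lemma linear_iso_ker (W W' : lmodType F) (phi : {linear V -> W}) (psi : {linear V -> W'}) :
  (forall y, exists x, phi x = y) -> (forall y, exists x, psi x = y) ->
  (forall x, phi x = 0 <-> psi x = 0) -> linear_iso W W'.
Proof.
move=> phi_surj psi_surj ker.
have [s sK] := choice phi_surj; have [t tK] := choice psi_surj.
have eq_ker x x' : phi x = phi x' <-> psi x = psi x'.
  split=> /eqP; rewrite -subr_eq0 -linearB => /eqP /ker /eqP;
    by rewrite linearB subr_eq0 => /eqP.
pose f y := psi (s y).
have f_lin : linear f.
  by move=> c y y'; rewrite /f -linearP; apply/eq_ker; rewrite linearP !sK.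
pose fL := GRing.isLinear.Build F W W' _ f f_lin.
exists (HB.pack f fL : {linear _ -> _}); exists (fun y => phi (t y)) => y /=.
  by rewrite -[RHS]sK; apply/eq_ker; rewrite tK.
by rewrite -[RHS]tK; apply/eq_ker; rewrite sK.
Qed.

Lemma linear_iso_quot (S : submodClosed V) (W : lmodType F) (phi : {linear V -> W}) :
  (forall y, exists x, phi x = y) -> (forall x, phi x = 0 <-> x \in S) ->
  linear_iso (lmod_quot S) W.
Proof.
move=> phi_surj phi_ker; apply: (linear_iso_ker (phi := quot_class S) _ phi_surj) => [y|x].
  by have [x ->] := quot_class_surj y; exists x.
rewrite phi_ker -{1}(linear0 (quot_class S)).
by split=> [/quot_classP|xS]; [rewrite subr0 | apply/quot_classP; rewrite subr0].
Qed.

End LinearIsos.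

Lemma linear_iso_trans (F : nzRingType) (U V W : lmodType F) :
  linear_iso U V -> linear_iso V W -> linear_iso U W.
Proof. by move=> [f bf] [g bg]; exists (g \o f); apply: bij_comp. Qed.

Section Codimension.
Variables (F : fieldType) (V : lmodType F).

(** Codimension through a surjection onto row vectors: it applies to ideals
    given by a mere predicate. *)
Definition has_codim (I : V -> Prop) (k : nat) : Prop :=
  exists2 phi : {linear V -> 'rV[F]_k},
    forall y, exists x, phi x = y & forall x, phi x = 0 <-> I x.

(** A section of phi followed by psi is an injective map between spaces of row
    vectors. *)
Lemma leq_codim (I : V -> Prop) k l : has_codim I k -> has_codim I l -> (k <= l)%N.
Proof.
move=> [phi phi_surj phi_ker] [psi psi_surj psi_ker].
have /fin_all_exists[x xE] (i : 'I_k) : exists x, phi x = delta_mx 0 i by exact: phi_surj.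
pose h (v : 'rV[F]_k) : V := \sum_i v 0 i *: x i.
have hphi v : phi (h v) = v.
  rewrite linear_sum [RHS]row_sum_delta; apply: eq_bigr => i _.
  by rewrite linearZ xE.
have hlin : linear h.
  move=> c u v; rewrite /h scaler_sumr -big_split; apply: eq_bigr => i _ /=.
  by rewrite !mxE scalerDl scalerA.
pose hL := GRing.isLinear.Build F 'rV[F]_k V _ h hlin.
pose H : {linear 'rV[F]_k -> V} := HB.pack h hL.
pose g := linfun (psi \o H).
have : lker g == 0%VS.
  apply/eqP/vspaceP=> v; rewrite memv_ker memv0 lfunE /=; apply/eqP/eqP => [p0|->].
    by rewrite -(hphi v); apply/phi_ker/psi_ker.
  by rewrite (_ : h 0 = 0) ?linear0 //; exact: (linear0 H).
move=> g0; have := limg_dim_eq (f := g) (U := fullv).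
rewrite (eqP g0) capv0 => /(_ erefl).
have := dimvS (subvf (limg g)); rewrite !dimvf => le_g eq_g; rewrite eq_g in le_g.
by have : (1 * k <= 1 * l)%N := le_g; rewrite !mul1n.
Qed.

Lemma codim_unique (I : V -> Prop) k l : has_codim I k -> has_codim I l -> k = l.
Proof. by move=> Ik Il; apply/eqP; rewrite eqn_leq !(leq_codim (I := I)). Qed.

Lemma has_dim_quot (S : submodClosed V) k :
  has_codim (fun v => v \in S) k -> has_dim (lmod_quot S) k.
Proof. by case=> phi; exact: linear_iso_quot. Qed.

End Codimension.

(** * The codimension of the ideal *)

Section Ideals.
Variables (F : comNzRingType) (d : nat) (f : 'I_d -> {mpoly F[d]}).
Implicit Types p q : {mpoly F[d]}.

Definition in_ideal p : Prop := exists a : 'I_d -> {mpoly F[d]}, p = \sum_j a j * f j.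

Lemma in_ideal0 : in_ideal 0.
Proof. by exists (fun=> 0); rewrite big1 // => j _; rewrite mul0r. Qed.

Lemma in_idealD p q : in_ideal p -> in_ideal q -> in_ideal (p + q).
Proof.
move=> [a ->] [b ->]; exists (fun j => a j + b j); rewrite -big_split.
by apply: eq_bigr => j _; rewrite mulrDl.
Qed.

Lemma in_idealM p q : in_ideal q -> in_ideal (p * q).
Proof.
move=> [a ->]; exists (fun j => p * a j); rewrite mulr_sumr.
by apply: eq_bigr => j _; rewrite mulrA.
Qed.

Lemma in_idealZ c p : in_ideal p -> in_ideal (c *: p).
Proof. by rewrite -mul_mpolyC; apply: in_idealM. Qed.

Lemma in_ideal_sum (I : Type) (r : seq I) (Q : pred I) (p : I -> {mpoly F[d]}) :
  (forall i, Q i -> in_ideal (p i)) -> in_ideal (\sum_(i <- r | Q i) p i).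
Proof. by move=> Ip; apply: (big_ind in_ideal) => //; [exact: in_ideal0 | move=> *; exact: in_idealD]. Qed.

Lemma in_ideal_gen j : in_ideal (f j).
Proof.
exists (fun k => (k == j)%:R); rewrite (bigD1 j) //= eqxx mul1r big1 ?addr0 // => k /negPf->.
by rewrite mul0r.
Qed.

(** A monomial of degree > d N has an exponent >= N. *)
Lemma in_ideal_monomial N (u : 'X_{1..d}) : (forall j, in_ideal ('X_j ^+ N)) ->
  (d * N < mdeg u)%N -> in_ideal 'X_[u].
Proof.
move=> XN; have [/existsP[j Nj] _|] := boolP [exists j, (N <= u j)%N].
  have -> : 'X_[u] = 'X_[u - U_(j) *+ N] * 'X_j ^+ N :> {mpoly F[d]}.
    rewrite mpolyXn -mpolyXD submK //; apply/mnm_lepP=> i.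
    by rewrite mulmnE mnm1E; case: eqP => [<-|_] //; rewrite mul1n.
  exact: in_idealM.
rewrite negb_exists => /forallP uN; rewrite mdegE ltnNge => /negP[].
have -> : (d * N = \sum_(j < d) N)%N by rewrite sum_nat_const card_ord.
apply: leq_sum => j _.
by rewrite leqNgt; apply: contra (uN j) => /ltnW.
Qed.

End Ideals.

Section KoszulCodim.
Variables (F : fieldType) (d r N : nat) (f : 'I_d -> {mpoly F[d]}).
Hypothesis homog_f : forall j, f j \is r.-homog.
Hypothesis Xn_in : forall j, in_ideal f ('X_j ^+ N).
Implicit Types p : {mpoly F[d]}.

Definition top_form p : dform F d := [ffun S : {set 'I_d} => if S == setT then p else 0].

Fact top_form_linear : linear top_form.
Proof.
by move=> c p q; apply/ffunP=> S; rewrite !ffunE; case: eqP; rewrite ?scaler0 ?addr0.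
Qed.

HB.instance Definition _ := GRing.isLinear.Build F {mpoly F[d]} (dform F d) _
  top_form top_form_linear.

Lemma is_form_top p : is_form d%:Z (top_form p).
Proof.
apply/is_formP=> S dS; rewrite ffunE; case: eqP => // ST.
by rewrite ST cardsT card_ord eqxx in dS.
Qed.

Lemma top_formE w : is_form d%:Z w -> w = top_form (w setT).
Proof.
move=> /is_formP dw; apply/ffunP=> S; rewrite ffunE; case: eqP => [->//|/eqP ST].
rewrite dw //; apply: contra ST => /eqP [cS].
by rewrite eqEcard subsetT cardsT card_ord cS /=.
Qed.

Lemma top_form_filter P p : form_filter P (top_form p) = top_form (mfilter P p).
Proof.
by apply/ffunP=> S; rewrite form_filterE !ffunE; case: eqP; rewrite ?linear0.
Qed.

Lemma koszul_top_ideal w : in_ideal f (koszul f w setT).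
Proof.
exists (fun j => wedge (dx j) w setT); rewrite sum_ffunE.
by apply: eq_bigr => j _; rewrite fscaleE mulrC.
Qed.

(** In top degree the Koszul differential of contraction with a is
    multiplication by sum_j a_j f_j. *)
Lemma ideal_koszul_top p : in_ideal f p ->
  exists2 u, is_form (d%:Z - 1) u & top_form p = koszul f u.
Proof.
move=> [a ->]; exists (koszul_homotopy a (top_form 1)).
  by apply: is_form_koszul_homotopy; apply: is_form_top.
have := koszul_homotopyP f a (top_form 1).
have -> : koszul f (top_form 1) = 0.
  by apply: (is_form_eq0 (is_form_koszul f (is_form_top 1))); rewrite -PoszD addn1 !lez_nat ltnn.
rewrite (_ : koszul_homotopy a 0 = 0) ?addr0 => [->|].
  by apply/ffunP=> S; rewrite fscaleE !ffunE; case: eqP; rewrite ?mulr1 ?mulr0.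
by rewrite /koszul_homotopy big1 // => j _; rewrite !linear0.
Qed.

Let M := (d * N).+1.
Let B := (M + r)%N.
Let U := tspace F d B d.+1 M.
Let W := (tkoszul B f @: tspace F d B d (M - r))%VS.

Let MB : (M <= B)%N. Proof. exact: leq_addr. Qed.

Let sub_WU : (W <= U)%VS.
Proof.
apply/subvP=> v /memv_imgP[y /tspaceP[dy yn] ->].
have ky := treal_tkoszul homog_f MB yn; apply/tspaceP; rewrite ky; split.
  by rewrite -addn1 PoszD addrK -[d%:Z](subrK 1); apply: is_form_koszul.
exact: deg_lt_koszul yn.
Qed.

Let low p := mfilter (fun k => (k < M)%N) p.
Let x p := tcoord B (top_form (low p)).

Let low_ideal p : in_ideal f (p - low p).
Proof.
rewrite [p - _]mpolyE; apply: in_ideal_sum => u _; rewrite mcoeffB mcoeff_filter.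
have [ltu|Mu] := ltnP (mdeg u) M; first by rewrite subrr scale0r; apply: in_ideal0.
by apply/in_idealZ/(in_ideal_monomial Xn_in).
Qed.

Let x_ideal p : (x p \in W) <-> in_ideal f p.
Proof.
have xr : treal (x p) = top_form (low p).
  apply: tcoord_deg_lt; rewrite -top_form_filter.
  by apply: (deg_lt_le MB); apply: deg_lt_filter.
split=> [/memv_imgP[y /tspaceP[dy yn] xy]|].
  rewrite -(subrK (low p) p); apply: in_idealD => //.
  have -> : low p = koszul f (treal y) setT.
    by rewrite -(treal_tkoszul homog_f MB yn) -xy xr ffunE eqxx.
  exact: koszul_top_ideal.
move=> /ideal_koszul_top[u du pu].
pose u' := form_filter (fun k => (k < M - r)%N) u.
have u'r : treal (tcoord B u') = u'.
  by apply: tcoord_deg_lt; apply: deg_lt_le (deg_lt_filter _ _); rewrite (leq_trans (leq_subr _ _)).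
have -> : x p = tkoszul B f (tcoord B u').
  by rewrite tkoszulE u'r -(filter_koszul_lt _ _ homog_f) -pu top_form_filter.
apply/memv_img/tcoord_tspace; last exact: deg_lt_filter.
  by rewrite (leq_trans (leq_subr _ _)).
exact: is_form_filter.
Qed.

(** Monomials of large degree lie in the ideal, so the quotient is computed by
    truncated top forms modulo the image of the Koszul operator; a linear
    complement of this image gives the coordinates. *)
Lemma codim_koszul : has_codim (in_ideal f) (\dim U - \dim W).
Proof.
pose C := (U :\: W)%VS.
have dC : \dim C = (\dim U - \dim W)%N.
  by rewrite -(dimv_cap_compl U W) (capv_idPr sub_WU) addKn.
rewrite -dC; have CW : (C :&: W = 0)%VS by apply: capv_diff.
have CWU : (C + W = U)%VS by rewrite addv_diff; apply/addv_idPl.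
have xU p : x p \in U.
  apply: tcoord_tspace => //; first by rewrite -addn1 PoszD addrK; apply: is_form_top.
  by rewrite -top_form_filter; apply: deg_lt_filter.
pose phi p : 'rV[F]_(\dim C) := \row_i coord (vbasis C) i (daddv_pi C W (x p)).
have phi_lin : linear phi.
  move=> c p q; apply/rowP=> i; rewrite !mxE.
  by rewrite /x /low !linearP.
pose phiL := GRing.isLinear.Build F {mpoly F[d]} 'rV[F]_(\dim C) _ phi phi_lin.
exists (HB.pack phi phiL : {linear _ -> _}) => [y|p] /=.
  pose c := \sum_i y 0 i *: (vbasis C)`_i.
  have cC : c \in C by apply: memv_suml => i _; apply/memvZ/vbasis_mem/memt_nth.
  have /tspaceP[dc cM] : c \in U by rewrite -CWU; apply: subvP cC; apply: addvSl.
  exists (treal c setT); apply/rowP=> i; rewrite mxE.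
  have -> : x (treal c setT) = c.
    rewrite /x -top_form_filter -top_formE ?cM ?trealK //.
    by move: dc; rewrite -addn1 PoszD addrK.
  rewrite daddv_pi_id // /c coord_sum_free //; exact/basis_free/vbasisP.
have phi0 : phi p = 0 <-> daddv_pi C W (x p) = 0.
  split=> [p0|p0]; last by apply/rowP=> i; rewrite !mxE p0 linear0.
  rewrite (coord_vbasis (memv_pi C W (x p))) big1 // => i _.
  by move/rowP/(_ i): p0; rewrite !mxE => ->; rewrite scale0r.
have xCW : x p \in (C + W)%VS by rewrite CWU.
split=> [/phi0 p0|Ip].
  by apply/x_ideal; rewrite -(daddv_pi_add CW xCW) p0 add0r memv_pi.
apply/phi0; move/x_ideal: Ip => xW.
apply: (addIr (daddv_pi W C (x p))); rewrite daddv_pi_add // add0r daddv_pi_id //.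
by rewrite capvC.
Qed.

End KoszulCodim.

(** The monomials with all exponents < r form a basis of the quotient. *)
Lemma codim_powers (F : fieldType) (d r : nat) :
  has_codim (in_ideal (fun j : 'I_d => 'X_j ^+ r : {mpoly F[d]})) (r ^ d).
Proof.
have cT : #|{: {ffun 'I_d -> 'I_r}}| = (r ^ d)%N by rewrite card_ffun !card_ord.
rewrite -cT; pose T := {ffun 'I_d -> 'I_r}.
pose mon (t : T) : 'X_{1..d} := [multinom t j : nat | j < d].
have mon_inj : injective mon.
  move=> t t' /mnmP tt'; apply/ffunP=> j; apply: val_inj.
  by have := tt' j; rewrite !mnmE.
pose phi (p : {mpoly F[d]}) : 'rV[F]_#|{: T}| := \row_i p@_(mon (enum_val i)).
have phi_lin : linear phi.
  by move=> c p q; apply/rowP=> i; rewrite !mxE mcoeffD mcoeffZ.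
pose phiL := GRing.isLinear.Build F {mpoly F[d]} 'rV[F]_#|{: T}| _ phi phi_lin.
exists (HB.pack phi phiL : {linear _ -> _}) => [y|p] /=.
  exists (\sum_i y 0 i *: 'X_[mon (enum_val i)]); apply/rowP=> i; rewrite mxE raddf_sum /=.
  rewrite (bigD1 i) //= mcoeffZ mcoeffX eqxx mulr1 big1 ?addr0 // => k /negPf ki.
  by rewrite mcoeffZ mcoeffX (inj_eq mon_inj) (inj_eq enum_val_inj) ki mulr0.
split=> [p0|[a ->]].
  rewrite [p]mpolyE; apply: in_ideal_sum => u _.
  have [/existsP[j rj]|] := boolP [exists j, (r <= u j)%N].
    apply: in_idealZ; have -> : 'X_[u] = 'X_[u - U_(j) *+ r] * 'X_j ^+ r :> {mpoly F[d]}.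
      rewrite mpolyXn -mpolyXD submK //; apply/mnm_lepP=> i.
      by rewrite mulmnE mnm1E; case: eqP => [<-|_] //; rewrite mul1n.
    exact/in_idealM/(in_ideal_gen (fun j => 'X_j ^+ r)).
  rewrite negb_exists => /forallP ur.
  have ltu j : (u j < r)%N by rewrite ltnNge ur.
  have -> : u = mon [ffun j => Ordinal (ltu j)] by apply/mnmP=> j; rewrite mnmE ffunE.
  move/rowP/(_ (enum_rank [ffun j => Ordinal (ltu j)])): p0; rewrite !mxE enum_rankK => ->.
  by rewrite scale0r; apply: in_ideal0.
apply/rowP=> i; rewrite !mxE raddf_sum big1 //= => j _.
set t := enum_val i; apply: mcoeffM_eq0 => u1 u2 e.
rewrite mcoeffXn; case: eqP => [e2|_]; last by rewrite mulr0.
have := congr1 (fun u : 'X_{1..d} => u j) e; rewrite mnmDE mnmE => ej.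
by have := ltn_ord (t j); rewrite ej -e2 mulmnE mnm1E eqxx mul1n ltnNge leq_addl.
Qed.

(** The codimension found in [codim_koszul] only depends on ranks that f
    shares with the system of the x_j^r. *)
Lemma codim_ideal (F : fieldType) (d r N : nat) (f : 'I_d -> {mpoly F[d]}) :
  (forall j, f j \is r.-homog) -> (forall j, in_ideal f ('X_j ^+ N)) ->
  has_codim (in_ideal f) (r ^ d).
Proof.
move=> hf fX; pose g j : {mpoly F[d]} := 'X_j ^+ r.
have hg j : g j \is r.-homog by rewrite /g mpolyXn dhomogX /= mdegMn mdeg1 mul1n.
(* A common exponent lets the same truncation serve both systems. *)
have fX' j : in_ideal f ('X_j ^+ (N + r)) by rewrite addnC exprD; apply: in_idealM.
have gX' j : in_ideal g ('X_j ^+ (N + r)) by rewrite exprD; apply/in_idealM/in_ideal_gen.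
have cf := codim_koszul hf fX'; have cg := codim_koszul hg gX'.
have [a fa] := fin_all_exists fX'; have [b gb] := fin_all_exists gX'.
rewrite (trank_unique hf hg fa gb (leqnn d)) ?leq_add2r ?leq_subr // in cf.
by rewrite (codim_unique (codim_powers F d r) cg).
Qed.

(** * Linear extension from monomials *)

Section LinearExtension.
Variables (F : comNzRingType) (d : nat) (V : lmodType F).

Definition poly_extend (phi : 'X_{1..d} -> V) (p : {mpoly F[d]}) : V :=
  \sum_(u <- msupp p) p@_u *: phi u.

Lemma poly_extendE phi n (p : {mpoly F[d]}) : (msize p <= n)%N ->
  poly_extend phi p = \sum_(u : 'X_{1..d < n}) p@_u *: phi u.
Proof.
move=> pn; rewrite /poly_extend (big_mksub 'X_{1..d < n}) //=; first last.
  by move=> u /msize_mdeg_lt /leq_trans /(_ pn) ->.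
  by rewrite msupp_uniq.
by rewrite big_rmcond //= => u /memN_msupp_eq0 ->; rewrite scale0r.
Qed.

Fact poly_extend_linear phi : linear (poly_extend phi).
Proof.
move=> c p q; pose n := maxn (msize (c *: p + q)) (maxn (msize p) (msize q)).
rewrite (@poly_extendE _ n (_ + _)) ?leq_maxl // (@poly_extendE _ n p) ?(@poly_extendE _ n q) //.
- rewrite scaler_sumr -big_split; apply: eq_bigr => u _ /=.
  by rewrite mcoeffD mcoeffZ scalerDl scalerA.
- by rewrite !leq_max leqnn !orbT.
- by rewrite !leq_max leqnn !orbT.
Qed.

HB.instance Definition _ phi := GRing.isLinear.Build F {mpoly F[d]} V _
  (poly_extend phi) (poly_extend_linear phi).

Lemma poly_extendX phi u : poly_extend phi 'X_[u] = phi u.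
Proof. by rewrite /poly_extend msuppX big_seq1 mcoeffX eqxx scale1r. Qed.

Lemma mpoly_linear_ext (A A' : {linear {mpoly F[d]} -> V}) :
  (forall u, A 'X_[u] = A' 'X_[u]) -> A =1 A'.
Proof.
move=> AA' p; rewrite [p]mpolyE (linear_sum A) (linear_sum A'); apply: eq_bigr => u _.
by rewrite (linearZ_LR A) (linearZ_LR A') /= AA'.
Qed.

Definition form_extend (phi : {set 'I_d} -> 'X_{1..d} -> V) (w : dform F d) : V :=
  \sum_(S : {set 'I_d}) poly_extend (phi S) (w S).

Fact form_extend_linear phi : linear (form_extend phi).
Proof.
move=> c v w; rewrite /form_extend scaler_sumr -big_split; apply: eq_bigr => S _ /=.
by rewrite formDE formZE linearP.
Qed.

HB.instance Definition _ phi := GRing.isLinear.Build F (dform F d) V _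
  (form_extend phi) (form_extend_linear phi).

End LinearExtension.

(** * Forms with homogeneous coefficients *)

Section CoefHomog.
Variables (F : comNzRingType) (d : nat).
Implicit Types (w : dform F d) (k : int).

Lemma coef_homogP k w :
  coef_homog k w <-> (forall S u, (mdeg u)%:Z != k -> (w S)@_u = 0).
Proof.
split=> [wk S u uk|wk S u uw]; first by apply/memN_msupp_eq0; apply: contra uk => /wk->.
apply/eqP; rewrite mcoeff_msupp in uw; apply: contraNT uw => uk.
by rewrite wk.
Qed.

Lemma coef_homogD k w w' : coef_homog k w -> coef_homog k w' -> coef_homog k (w + w').
Proof.
move=> /coef_homogP wk /coef_homogP wk'; apply/coef_homogP=> S u uk.
by rewrite formDE mcoeffD wk // wk' // addr0.
Qed.

Lemma coef_homogN k w : coef_homog k w -> coef_homog k (- w).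
Proof.
by move=> /coef_homogP wk; apply/coef_homogP=> S u uk; rewrite formNE mcoeffN wk // oppr0.
Qed.

Lemma coef_homogZ k c w : coef_homog k w -> coef_homog k (c *: w).
Proof.
by move=> /coef_homogP wk; apply/coef_homogP=> S u uk; rewrite formZE mcoeffZ wk // mulr0.
Qed.

Lemma coef_homog0 k : coef_homog k (0 : dform F d).
Proof. by apply/coef_homogP=> S u uk; rewrite form0E mcoeff0. Qed.

Lemma coef_homog_sum k (I : eqType) (s : seq I) (Q : pred I) (w : I -> dform F d) :
  (forall i, i \in s -> Q i -> coef_homog k (w i)) -> coef_homog k (\sum_(i <- s | Q i) w i).
Proof.
move=> wk; rewrite big_seq_cond; apply: (big_ind (coef_homog k)) => [|w1 w2|i /andP[]].
- exact: coef_homog0.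
- exact: coef_homogD.
- exact: wk.
Qed.

Lemma coef_homog_koszul k r (f : 'I_d -> {mpoly F[d]}) w : (forall j, f j \is r.-homog) ->
  coef_homog k w -> coef_homog (k + r%:Z) (koszul f w).
Proof.
move=> hf /coef_homogP wk; apply: coef_homog_sum => j _ _; apply/coef_homogP=> S u uk.
rewrite fscaleE wedge_dxE; case: ifP => _; last by rewrite mulr0 mcoeff0.
have -> : (-1) ^+ below j S = ((-1) ^+ below j S)%:MP :> {mpoly F[d]}.
  by rewrite rmorphXn rmorphN rmorph1.
rewrite mulrCA mcoeffCM mcoeffM_eq0 ?mulr0 // => u1 u2 eu.
have [du1|du1] := eqVneq (mdeg u1) r; last by rewrite (dhomog_nemf_coeff (hf j) du1) mul0r.
rewrite [X in _ * X]wk ?mulr0 //; apply: contra uk => /eqP <-.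
by rewrite eu mdegD du1 addnC PoszD.
Qed.

Lemma coef_homog_filter n w : coef_homog n%:Z (form_filter (pred1 n) w).
Proof.
apply/coef_homogP=> S u un; rewrite form_filterE mcoeff_filter /=.
by rewrite (_ : (mdeg u == n) = false) //; apply: negbTE; rewrite -eqz_nat.
Qed.

Lemma coef_homog_id n w : coef_homog n%:Z w -> form_filter (pred1 n) w = w.
Proof.
move=> /coef_homogP wn; apply/ffunP=> S; rewrite form_filterE; apply/mpolyP=> u.
by rewrite mcoeff_filter /=; case: eqP => // /eqP un; rewrite wn // eqz_nat.
Qed.

Lemma form_filter_sum n w : deg_lt n w -> w = \sum_(k < n) form_filter (pred1 (k : nat)) w.
Proof.
move=> /deg_ltP wn; apply/ffunP=> S; rewrite sum_ffunE; apply/mpolyP=> u; rewrite raddf_sum /=.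
have [un|nu] := ltnP (mdeg u) n; last first.
  rewrite wn // big1 // => k _; rewrite form_filterE mcoeff_filter /=.
  by rewrite wn // if_same.
rewrite (bigD1 (Ordinal un)) //= form_filterE mcoeff_filter /= eqxx big1 ?addr0 // => k nk.
by rewrite form_filterE mcoeff_filter /= eq_sym (negPf (nk : k != mdeg u :> nat)).
Qed.

(** Used to check identities between homogeneous operators one bidegree at a
    time. *)
Lemma bihomogeneous_ext (V : lmodType F) (A A' : {linear dform F d -> V}) :
  (forall (p n : nat) w, is_form p%:Z w -> coef_homog n%:Z w -> A w = A' w) -> A =1 A'.
Proof.
move=> AA' w; rewrite [w]form_part_sum !linear_sum; apply: eq_bigr => p _ /=.
have [n wn] := deg_lt_exists (form_part p%:Z w).
rewrite (form_filter_sum wn) !linear_sum; apply: eq_bigr => k _ /=.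
apply: AA'; last exact: coef_homog_filter.
by apply: is_form_filter; apply: is_form_part.
Qed.

(** If n < r the truncated difference is 0 and the conclusion says that T w =
    0. *)
Lemma lowers_deg_lt (r n : nat) (T : {linear dform F d -> dform F d}) w :
  lowers_degree_by r%:Z T -> deg_lt n w -> deg_lt (n - r) (T w).
Proof.
move=> lT wn; rewrite (form_filter_sum wn) linear_sum; apply/deg_ltP=> S u nu.
rewrite sum_ffunE raddf_sum big1 //= => k _.
have /coef_homogP := lT _ _ (@coef_homog_filter k w); apply.
apply/eqP => uk; have {}uk : (mdeg u + r)%N = k.
  by apply/eqP; rewrite -eqz_nat PoszD uk subrK.
by have := ltn_ord k; rewrite ltnNge -uk addnC -leq_subLR nu.
Qed.

End CoefHomog.

(** * A bihomogeneous generalized inverse of the Koszul operator *)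

Section GeneralizedInverse.
Variables (F : fieldType) (d r : nat) (f : 'I_d -> {mpoly F[d]}).
Hypothesis homog_f : forall j, f j \is r.-homog.
Implicit Types (w : dform F d) (S : {set 'I_d}) (u : 'X_{1..d}).

Definition mono_form S u : dform F d := [ffun T => if T == S then 'X_[u] else 0].

Lemma mono_form_sum w : w = \sum_S \sum_(u <- msupp (w S)) (w S)@_u *: mono_form S u.
Proof.
apply/ffunP=> T; rewrite sum_ffunE (bigD1 T) //= [X in _ + X]big1 => [|S ST].
  rewrite addr0 sum_ffunE [LHS]mpolyE; apply: eq_bigr => u _.
  by rewrite formZE ffunE eqxx.
rewrite sum_ffunE big1 // => u _; rewrite formZE ffunE eq_sym (negPf ST).
by rewrite scaler0.
Qed.

(** In a truncated space every linear map has a generalized inverse; only its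
    component of the expected bidegree is kept. A monomial of degree n is
    treated in the space of forms of degree <= n. *)
Definition ginv_mono S u : dform F d :=
  if (r <= mdeg u)%N then
    form_part (#|S|%:Z - 1) (form_filter (pred1 (mdeg u - r)%N)
      (treal ((tkoszul (mdeg u).+1 f)^-1%VF (tcoord (mdeg u).+1 (mono_form S u)))))
  else 0.

Definition ginv : dform F d -> dform F d := form_extend ginv_mono.

HB.instance Definition _ := GRing.Linear.on ginv.

Lemma ginvE (p n : nat) w : is_form p.+1%:Z w -> coef_homog (n + r)%N%:Z w ->
  ginv w = form_part p%:Z (form_filter (pred1 n)
    (treal ((tkoszul (n + r).+1 f)^-1%VF (tcoord (n + r).+1 w)))).
Proof.
move=> /is_formP pw wn; rewrite {2}[w]mono_form_sum !linear_sum; apply: eq_bigr => S _ /=.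
rewrite /poly_extend !linear_sum; apply: eq_big_seq => u uw; rewrite !linearZ; congr (_ *: _).
have Sp : #|S| = p.+1.
  have [/eqP|/pw w0] := eqVneq #|S|%:Z p.+1%:Z; first by rewrite eqz_nat => /eqP.
  by rewrite w0 msupp0 in uw.
have un : mdeg u = (n + r)%N by apply/eqP; rewrite -eqz_nat; apply/eqP/(wn S).
by rewrite /ginv_mono un leq_addl addnK Sp -addn1 PoszD addrK.
Qed.

(** For w of bidegree (p, n), the form D w sits in a single truncated space,
    where D y = D w for the chosen y. Both sides being bihomogeneous, this
    survives taking the component of y of bidegree (p, n). *)
Lemma koszul_ginv_koszul w : koszul f (ginv (koszul f w)) = koszul f w.
Proof.
pose A := koszul f \o ginv \o koszul f; move: w.
apply: (bihomogeneous_ext (A := A) (A' := koszul f)) => p n w pw wn /=.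
have pkw : is_form p.+1%:Z (koszul f w) by rewrite -addn1 PoszD; apply: is_form_koszul.
have kwn : coef_homog (n + r)%N%:Z (koszul f w) by rewrite PoszD; apply: coef_homog_koszul.
rewrite (ginvE pkw kwn) -form_part_koszul.
set B := (n + r).+1; set D := tkoszul B f; set y := (D^-1%VF _).
have <- : form_filter (pred1 (n + r)%N) (koszul f (treal y)) =
    koszul f (form_filter (pred1 n) (treal y)).
  by apply: (form_filter_koszul _ homog_f) => k; rewrite /= eqn_add2r.
have -> : form_filter (pred1 (n + r)%N) (koszul f (treal y)) =
    form_filter (pred1 (n + r)%N) (treal (D y)).
  rewrite tkoszulE tcoordK form_filter_comp; apply: eq_form_filter => k /=.
  by case: eqP => //= ->; rewrite ltnSn.
have wB : deg_lt B w.
  apply/deg_ltP=> S u Bu; move/coef_homogP: wn; apply.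
  by rewrite eqz_nat neq_ltn (leq_trans _ Bu) ?orbT // ltnS leq_addr.
have kwB : deg_lt B (koszul f w).
  apply/deg_ltP=> S u Bu; move/coef_homogP: kwn; apply.
  by rewrite eqz_nat neq_ltn Bu orbT.
have -> : D y = tcoord B (koszul f w).
  rewrite /y -{1}(tcoord_deg_lt wB) -tkoszulE limg_lfunVK ?memv_img ?memvf //.
  by rewrite tkoszulE tcoord_deg_lt.
rewrite tcoord_deg_lt // coef_homog_id //.
by rewrite form_part_id // addrC -PoszD.
Qed.

Lemma is_form_ginv (p : int) w : is_form p w -> is_form (p - 1) (ginv w).
Proof.
move=> /is_formP pw; apply: is_form_sum => S _.
have [Sp|/pw ->] := eqVneq #|S|%:Z p; last by rewrite linear0; apply: is_form0.
apply: is_form_sum => u _; apply: is_formZ.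
rewrite /ginv_mono; case: ifP => _; last exact: is_form0.
by rewrite Sp; apply: is_form_part.
Qed.

Lemma coef_homog_ginv (k : int) w : coef_homog k w -> coef_homog (k - r%:Z) (ginv w).
Proof.
move=> wk; apply: coef_homog_sum => S _ _; apply: coef_homog_sum => u uw _; apply: coef_homogZ.
rewrite -(wk S u uw) /ginv_mono; case: leqP => ru; last exact: coef_homog0.
rewrite subzn //; set w' := treal _; move/coef_homogP: (@coef_homog_filter F d (mdeg u - r) w') => w'u.
apply/coef_homogP=> T v vu; rewrite form_partE; case: ifP => _; last by rewrite mcoeff0.
exact: w'u.
Qed.

End GeneralizedInverse.

(** * The contraction of the Koszul complex *)

Section Contraction.
Variables (F : fieldType) (d r N : nat) (f : 'I_d -> {mpoly F[d]}).
Hypothesis homog_f : forall j, f j \is r.-homog.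
Hypothesis Xn_in : forall j, in_ideal f ('X_j ^+ N).
Variables (V : lmodType F) (tau : {linear {mpoly F[d]} -> V}).
Hypothesis tau_surj : forall v, exists p, tau p = v.
Hypothesis tau_ker : forall p, tau p = 0 <-> in_ideal f p.
Implicit Types (w : dform F d).

Let D : {linear dform F d -> dform F d} := koszul f.
Let g : {linear dform F d -> dform F d} := ginv r f.

Definition mod_coboundary w := w - koszul f (ginv r f w).
Definition cocycle_part w := w - ginv r f (koszul f w).
Local Notation Q := mod_coboundary.
Local Notation Z := cocycle_part.

Fact mod_coboundary_linear : linear Q.
Proof. by move=> c u v; rewrite /Q (linearP g) (linearP D) opprD scalerBr addrACA. Qed.
Fact cocycle_part_linear : linear Z.
Proof. by move=> c u v; rewrite /Z (linearP D) (linearP g) opprD scalerBr addrACA. Qed.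
HB.instance Definition _ := GRing.isLinear.Build F (dform F d) (dform F d) _ Q mod_coboundary_linear.
HB.instance Definition _ := GRing.isLinear.Build F (dform F d) (dform F d) _ Z cocycle_part_linear.

Let DgD w : D (g (D w)) = D w. Proof. exact: koszul_ginv_koszul. Qed.
Let DD w : D (D w) = 0. Proof. exact: koszul_koszul. Qed.
Let QD w : Q (D w) = 0. Proof. by rewrite /Q DgD subrr. Qed.
Let DZ w : D (Z w) = 0. Proof. by rewrite /Z linearB DgD subrr. Qed.
Let Zg w : Z (g (D w)) = 0. Proof. by rewrite /Z DgD subrr. Qed.

Let top_closed w : is_form d%:Z w -> D w = 0.
Proof.
move=> dw; apply: (is_form_eq0 (is_form_koszul f dw)).
by rewrite -PoszD addn1 !lez_nat ltnn.
Qed.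

Let DgQ w : D (g (Q w)) = 0.
Proof.
have -> : Q w = w - D (g w) by [].
by rewrite (linearB g) (linearB D) (DgD (g w)) subrr.
Qed.

Let ZD w : Z (D w) = D w.
Proof.
have kk : koszul f (koszul f w) = 0 := DD w; have g0 : ginv r f 0 = 0 := linear0 g.
by rewrite /cocycle_part kk g0 subr0.
Qed.

Let cocycle_part_top w : is_form d%:Z w -> Z w = w.
Proof.
move=> dw; have kw : koszul f w = 0 := top_closed dw.
have g0 : ginv r f 0 = 0 := linear0 g.
by rewrite /cocycle_part kw g0 subr0.
Qed.

Let is_form_Q p w : is_form p w -> is_form p (Q w).
Proof.
move=> pw; apply: is_formB => //; rewrite -(subrK 1 p).
by apply/is_form_koszul/is_form_ginv.
Qed.

Let is_form_Z p w : is_form p w -> is_form p (Z w).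
Proof.
move=> pw; apply: is_formB => //; rewrite -(addrK 1 p).
by apply/is_form_ginv/is_form_koszul.
Qed.

Let QZ_lt p w : p != d%:Z -> is_form p w -> Q (Z w) = 0.
Proof.
move=> pd pw; have := is_form_Z pw; have [pr|/(is_form_eq0 pw)->] := boolP (0 <= p <= d%:Z); last by rewrite !linear0.
case: p pd pr pw => // p pd; rewrite !lez_nat /= => pd' pw zp.
have [a aE] := fin_all_exists Xn_in.
have [||u _ ->] := koszul_exact aE _ zp; [|exact: DZ|exact: QD].
by rewrite ltn_neqAle pd' andbT -eqz_nat.
Qed.

Let sec v : {mpoly F[d]} := projT1 (cid (tau_surj v)).
Let secK v : tau (sec v) = v. Proof. by rewrite /sec; case: cid. Qed.

Let Qtop p : tau p = 0 -> Q (top_form p) = 0.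
Proof. by move=> /tau_ker/ideal_koszul_top[u _ ->]; exact: QD. Qed.

Let iota v := Q (top_form (sec v)).

Let iota_tau p : iota (tau p) = Q (top_form p).
Proof.
apply/eqP; rewrite -subr_eq0 -(linearB Q) -linearB; apply/eqP/Qtop.
by rewrite linearB secK subrr.
Qed.

Let iota_linear : linear iota.
Proof.
move=> c u v; rewrite -{1}(secK u) -{1}(secK v) -linearP iota_tau.
by rewrite [top_form _]linearP linearP.
Qed.

Let pi w := tau (w setT).
Let pi_linear : linear pi.
Proof. by move=> c u v; rewrite /pi formDE formZE linearP. Qed.

Let h w := g (D (g (Z w))).
Let h_linear : linear h.
Proof. by move=> c u v; rewrite /h !linearP. Qed.

Let pi_D w : pi (D w) = 0.
Proof. by apply/tau_ker/koszul_top_ideal. Qed.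

Let pi_deg p w : p != d%:Z -> is_form p w -> pi w = 0.
Proof.
move=> pd /is_formP pw; rewrite /pi pw ?linear0 //.
by rewrite cardsT card_ord eq_sym.
Qed.

Let iota_pi_top w : is_form d%:Z w -> iota (pi w) = Q (Z w).
Proof.
move=> dw; rewrite (cocycle_part_top dw).
have := iota_tau (w setT); rewrite -(top_formE dw); exact.
Qed.

Let iota_pi w : iota (pi w) = Q (Z w).
Proof.
pose w' (p : 'I_d.+1) := form_part p%:Z w.
have w'_deg (p : 'I_d.+1) : is_form p%:Z (w' p) by apply: is_form_part.
have w'_lt (p : 'I_d.+1) : p != ord_max -> p%:Z != d%:Z.
  by move=> pd; rewrite eqz_nat; apply: contra pd => /eqP pd; apply/eqP/val_inj.
have Ew : w = \sum_p w' p by exact: form_part_sum.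
have -> : Q (Z w) = Q (Z (w' ord_max)).
  rewrite {1}Ew (linear_sum Z) (linear_sum Q) (bigD1 ord_max) // big1 => [|p pd].
    by rewrite [LHS]addr0.
  exact: QZ_lt (w'_lt p pd) (w'_deg p).
have -> : pi w = pi (w' ord_max).
  rewrite /pi {1}Ew sum_ffunE (linear_sum tau) (bigD1 ord_max) // big1 => [|p pd].
    by rewrite [LHS]addr0.
  exact: pi_deg (w'_lt p pd) (w'_deg p).
exact: iota_pi_top (w'_deg ord_max).
Qed.

Let pi_gD_form (p : int) w : is_form p w -> pi (g (D w)) = 0.
Proof.
move=> pw; have [pd|pd] := eqVneq p d%:Z.
  by rewrite pd in pw; rewrite (top_closed pw) (linear0 g) /pi form0E linear0.
by apply: (pi_deg pd); have := is_form_ginv r f (is_form_koszul f pw); rewrite addrK.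
Qed.

Let pi_gD w : pi (g (D w)) = 0.
Proof.
rewrite [w]form_part_sum (linear_sum D) (linear_sum g) /pi sum_ffunE (linear_sum tau).
rewrite big1 // => p _; exact: pi_gD_form (is_form_part p%:Z w).
Qed.

Let pi_Q w : pi (Q w) = pi w.
Proof. by rewrite {1}/pi formDE linearD formNE linearN /= [tau (D _ _)]pi_D subr0. Qed.

(** With Q = 1 - D g and Z = 1 - g D, exactness below degree d gives Q Z = 0
    there, and Q Z = Q in degree d; so Q Z = iota pi. Expanding Q Z and using
    D g D = D yields 1 - Q Z = D h + h D for h = g D g Z, and the side
    conditions follow from Z g D = 0 and D g Q = 0. *)
Lemma koszul_contraction :
  exists (iota : {linear V -> dform F d}) (pi : {linear dform F d -> V})
         (h : {linear dform F d -> dform F d}),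
    contraction (koszul f) iota pi h /\ lowers_degree_by r%:Z h.
Proof.
pose iotaL := GRing.isLinear.Build F V (dform F d) _ iota iota_linear.
pose piL := GRing.isLinear.Build F (dform F d) V _ pi pi_linear.
pose hL := GRing.isLinear.Build F (dform F d) (dform F d) _ h h_linear.
exists (HB.pack iota iotaL : {linear _ -> _}), (HB.pack pi piL : {linear _ -> _}),
  (HB.pack h hL : {linear _ -> _}).
have iota_d v : is_form d%:Z (iota v) by apply: is_form_Q; apply: is_form_top.
have h_deg p w : is_form p w -> is_form (p - 1) (h w).
  move=> pw; apply: is_form_ginv; rewrite -(subrK 1 p); apply: is_form_koszul.
  by apply: is_form_ginv; apply: is_form_Z.
split; [split|] => //=.
- by move=> v; apply/top_closed/iota_d.
- move=> w; rewrite iota_pi /h ZD (DgD w) (DgD (g (Z w))).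
  have -> : Q (Z w) = Z w - D (g (Z w)) by [].
  set X := D _; have -> : Z w = w - g (D w) by [].
  by rewrite opprB addrCA subKr.
- by move=> v; rewrite pi_Q /pi ffunE eqxx secK.
- by move=> w; rewrite /h Zg !linear0.
- by move=> w; exact: pi_gD.
- move=> v; rewrite /h.
  have -> : Z (iota v) = iota v by exact: cocycle_part_top (iota_d v).
  by rewrite /iota DgQ (linear0 g).
- move=> k w wk; apply: coef_homog_ginv; rewrite -(subrK r%:Z k); apply: (coef_homog_koszul homog_f).
  apply: coef_homog_ginv; apply: (coef_homogD (wk)); apply: coef_homogN.
  by have := @coef_homog_ginv _ _ r f _ _ (coef_homog_koszul homog_f wk); rewrite addrK.
Qed.

End Contraction.

(** * The Nullstellensatz over an uncountable field *)

Section WeakNullstellensatz.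
Variables (C : closedFieldType) (d : nat).
Hypothesis uncountable : ~ countable [set: C]%classic.
Implicit Types (p q : {mpoly C[d]}) (I : {mpoly C[d]} -> Prop).

Definition ideal_closed I : Prop :=
  [/\ I 0, forall p q, I p -> I q -> I (p + q) & forall p q, I q -> I (p * q)].

Definition adjoin I q : {mpoly C[d]} -> Prop := fun p => exists b, I (p - b * q).

Lemma adjoin_ideal I q : ideal_closed I -> ideal_closed (adjoin I q).
Proof.
move=> [I0 ID IM]; split=> [|p1 p2 [b1 Ib1] [b2 Ib2]|p1 p2 [b Ib]].
- by exists 0; rewrite mul0r subr0.
- by exists (b1 + b2); rewrite mulrDl opprD addrACA; apply: ID.
- by exists (p1 * b); rewrite -mulrA -mulrBr; apply: IM.
Qed.

Lemma adjoin_sub I q p : I p -> adjoin I q p.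
Proof. by move=> Ip; exists 0; rewrite mul0r subr0. Qed.

Lemma adjoin_gen I q : ideal_closed I -> adjoin I q q.
Proof. by case=> I0 _ _; exists 1; rewrite mul1r subrr. Qed.

(** A countable union of finite sets is countable. *)
Lemma infinite_fibre (n : C -> nat) :
  exists k, infinite_set [set c | n c = k]%classic.
Proof.
apply: contrapT => fin; apply: uncountable.
have -> : [set: C]%classic = (\bigcup_k [set c | n c = k])%classic.
  by apply/seteqP; split=> // c _; exists (n c).
apply: bigcup_countable => // k _; apply: finite_set_countable.
by apply: contrapT => nfin; apply: fin; exists k.
Qed.

(** Infinitely many of the polynomials b c have the same size, and polynomials
    of bounded size span a finite-dimensional space. *)
Lemma bounded_dependence (b : C -> {mpoly C[d]}) :
  exists m (c : 'I_m -> C) (a : 'I_m -> C) (i : 'I_m),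
    [/\ injective c, a i != 0 & \sum_l a l *: b (c l) = 0].
Proof.
have [k infk] := infinite_fibre (fun c => msize (b c)).
pose T := 'X_{1..d < k}; pose m := #|{: T}|.
have [Bk Bk_sub Bk_card] := infinite_set_fset m.+1 infk.
pose c (l : 'I_m.+1) := nth 0 (enum_fset Bk) l.
have ltc (l : 'I_m.+1) : (l < size (enum_fset Bk))%N.
  exact: leq_trans (ltn_ord l) Bk_card.
have c_inj : injective c.
  move=> l l' /eqP; rewrite nth_uniq ?fset_uniq //; [by move=> /eqP/val_inj | exact: ltc..].
have c_size l : msize (b (c l)) = k by apply: Bk_sub; apply: mem_nth.
pose A : 'M[C]_(m.+1, m) := \matrix_(l, u) (b (c l))@_(enum_val u : T).
have : kermx A != 0.
  rewrite kermx_eq0; apply/negP; rewrite /row_free => /eqP rA.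
  by have := rank_leq_col A; rewrite rA ltnn.
move=> /rowV0Pn[a aker a0]; exists m.+1, c, (fun l => a 0 l).
have [i ai] : exists i, a 0 i != 0 by apply/rV0Pn.
exists i; split=> //; apply/mpolyP=> u; rewrite mcoeff0 raddf_sum /=.
have [ltu|ku] := ltnP (mdeg u) k; last first.
  rewrite big1 // => l _; rewrite mcoeffZ memN_msupp_eq0 ?mulr0 //.
  by apply: msize_mdeg_ge; rewrite c_size.
have /sub_kermxP/rowP/(_ (enum_rank (BMultinom ltu : T))) := aker.
rewrite !mxE => E; rewrite -[RHS]E; apply: eq_bigr => l _.
by rewrite mcoeffZ mxE enum_rankK.
Qed.

(** Suppose that x_j - c has an inverse b_c modulo I for every c. Clearing
    denominators in a linear relation between finitely many b_c gives a
    polynomial P in x_j that lies in I. It is nonzero, since at the point c_i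
    it takes the value of the coefficient a_i times a nonzero product. Now P
    splits into factors x_j - z, which are invertible modulo I, so 1 is in
    I. *)
Lemma adjoin_proper I j : ideal_closed I -> ~ I 1 ->
  exists c : C, ~ adjoin I ('X_j - c%:A) 1.
Proof.
move=> [I0 ID IM] I1; apply: contrapT => noc; apply: I1.
have /choice[b bI] : forall c : C, exists b, I (1 - b * ('X_j - c%:A)).
  by move=> c; apply: contrapT => nb; apply: noc; exists c.
have [m [c [a [i [c_inj ai dep]]]]] := bounded_dependence b.
pose ev : {poly C} -> {mpoly C[d]} := horner_alg ('X_j : {mpoly C[d]}).
have evXB e : ev ('X - e%:P) = 'X_j - e%:A by rewrite /ev rmorphB /= horner_algX horner_algC.
have evZ e (q : {poly C}) : ev (e *: q) = e *: ev q.
  by rewrite -mul_polyC /ev rmorphM /= horner_algC mulr_algl.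
have drop e q : I (('X_j - e%:A) * q) -> I q.
  move=> Iq; rewrite (_ : q = q * (1 - b e * ('X_j - e%:A)) + b e * (('X_j - e%:A) * q)).
    by apply: ID; apply: IM.
  by rewrite mulrBr mulr1 [X in _ - X]mulrC -mulrA addrNK.
(* q l is the product of all the factors of Q except the l-th. *)
pose Q := \prod_l ('X - (c l)%:P : {poly C}).
pose q l := \prod_(k | k != l) ('X - (c k)%:P : {poly C}).
have Qq l : Q = ('X - (c l)%:P) * q l by rewrite /Q (bigD1 l).
pose P := \sum_l a l *: q l.
have IP : I (ev P).
  have -> : ev P = \sum_l (a l *: ev (q l)) * (1 - b (c l) * ('X_j - (c l)%:A)).
    have -> : ev P = \sum_l a l *: ev (q l).
      by rewrite /ev linear_sum; apply: eq_bigr => l _; exact: evZ.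
    rewrite [RHS](eq_bigr (fun l => a l *: ev (q l) - ev Q * (a l *: b (c l)))) => [|l _].
      by rewrite sumrB -mulr_sumr dep mulr0 subr0.
    rewrite mulrBr mulr1; congr (_ - _); rewrite (Qq l).
    have -> : ev (('X - (c l)%:P) * q l) = ('X_j - (c l)%:A) * ev (q l).
      by rewrite -evXB /ev rmorphM.
    rewrite -scalerAr -scalerAl; congr (_ *: _).
    by rewrite mulrA mulrC mulrA.
  by apply: big_ind => [||l _] //; apply: IM.
have P0 : P != 0.
  apply/eqP => P0; move: ai; have : P.[c i] = 0 by rewrite P0 horner0.
  rewrite horner_sum (bigD1 i) //= big1 => [|l li]; last first.
    by rewrite hornerZ /q (bigD1 i) ?(eq_sym i) //= hornerM hornerXsubC subrr mul0r mulr0.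
  rewrite addr0 hornerZ => /eqP; rewrite mulf_eq0 => /orP[->//|].
  rewrite horner_prod prodf_seq_eq0 => /hasP[k _ /andP[ki]].
  by rewrite hornerXsubC subr_eq0 => /eqP/c_inj ik; rewrite ik eqxx in ki.
have [rs Prs] := closed_field_poly_normal P.
have : I (ev (\prod_(z <- rs) ('X - z%:P))).
  have -> : \prod_(z <- rs) ('X - z%:P) = (lead_coef P)^-1 *: P.
    by rewrite {2}Prs scalerA mulVf ?lead_coef_eq0 // scale1r.
  by rewrite evZ -mulr_algl; apply: IM.
elim: rs {Prs} => [|z rs IHrs]; first by rewrite big_nil /ev rmorph1.
rewrite big_cons => Iz; apply: IHrs; apply: (drop z).
by rewrite -evXB /ev -rmorphM.
Qed.

Lemma adjoin_point I (s : seq 'I_d) : ideal_closed I -> ~ I 1 -> uniq s ->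
  exists (c : 'I_d -> C) J, [/\ ideal_closed J, forall p, I p -> J p, ~ J 1 &
    forall j, j \in s -> J ('X_j - (c j)%:A)].
Proof.
move=> Icl I1; elim: s => [|j s IHs] /=; first by exists (fun=> 0), I; split.
move=> /andP[js /IHs[c [J [Jcl IJ J1 Jc]]]].
have [cj J'1] := adjoin_proper j Jcl J1.
exists (fun k => if k == j then cj else c k), (adjoin J ('X_j - cj%:A)); split=> //.
- exact: adjoin_ideal.
- by move=> p /IJ; apply: adjoin_sub.
- move=> k; rewrite inE; case: eqP => [-> _|_ /= ks]; first exact: adjoin_gen.
  exact/adjoin_sub/Jc.
Qed.

(** Once all x_j - c_j belong to a proper ideal J, every polynomial is
    congruent to its value at c modulo J, and a constant in J is 0. *)
Lemma weak_nullstellensatz I : ideal_closed I -> ~ I 1 ->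
  exists c : 'I_d -> C, forall p, I p -> p.@[c] = 0.
Proof.
move=> Icl I1; have [c [J [[J0 JD JM] IJ J1 Jc]]] := adjoin_point Icl I1 (enum_uniq 'I_d).
exists c => p /IJ Jp.
have JB q q' : J q -> J q' -> J (q - q') by move=> ? ?; rewrite -mulN1r; apply/JD/JM.
pose Z q := J (q - (q.@[c])%:MP).
have ZD q q' : Z q -> Z q' -> Z (q + q').
  by move=> Zq Zq'; rewrite /Z mevalD mpolyCD opprD addrACA; apply: JD.
have ZM q q' : Z q -> Z q' -> Z (q * q').
  move=> Zq Zq'; rewrite /Z mevalM mpolyCM.
  rewrite (_ : _ - _ = q * (q' - (q'.@[c])%:MP) + (q'.@[c])%:MP * (q - (q.@[c])%:MP)).
    by apply: JD; apply: JM.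
  by rewrite !mulrBr [q'.@[c]%:MP * q]mulrC addrA addrNK [_%:MP * _%:MP]mulrC.
have ZC e : Z e%:MP by rewrite /Z mevalC subrr.
have ZX j : Z 'X_j by rewrite /Z mevalXU -alg_mpolyC; apply: Jc; rewrite mem_enum.
have Zp : Z p.
  rewrite [p]mpolyE; apply: (big_ind Z) => [|q q'|u _]; first by rewrite -mpolyC0.
    exact: ZD.
  rewrite -mul_mpolyC; apply: (ZM) => //; rewrite mpolyXE_id.
  apply: (big_ind Z) => [|q q'|j _]; [by rewrite -mpolyC1 | exact: ZM |].
  by elim: (u j) => [|n IHn]; [rewrite expr0 -mpolyC1 | rewrite exprS; apply: ZM].
have Jv : J (p.@[c])%:MP by rewrite -(subKr p (p.@[c])%:MP); apply: JB.
apply/eqP; apply: contra_notT J1 => v0.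
by rewrite -mpolyC1 -(mulVf v0) mpolyCM; apply: JM.
Qed.

(** By [weak_nullstellensatz], 1 is congruent to b (x_j - 1) modulo (f) for
    some b. As (f) is homogeneous, comparing components gives b_0 = -1 and
    b_(n+1) = x_j b_n modulo (f), hence b_n = - x_j^n; and b_n = 0 for large
    n. *)
Lemma homog_nullstellensatz (r : nat) (f : 'I_d -> {mpoly C[d]}) :
  (forall j, f j \is r.-homog) ->
  (forall x : 'I_d -> C, (forall j, (f j).@[x] = 0) -> forall j, x j = 0) ->
  exists N, forall j, in_ideal f ('X_j ^+ N).
Proof.
move=> hf zf.
have fcl : ideal_closed (in_ideal f).
  by split; [exact: in_ideal0 | move=> *; exact: in_idealD | move=> *; exact: in_idealM].
suff /choice[N XN] : forall j, exists n, in_ideal f ('X_j ^+ n).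
  exists (\max_j N j) => j.
  by rewrite -(subnK (leq_bigmax j : (N j <= _)%N)) exprD; apply: in_idealM.
move=> j.
have [b bI] : adjoin (in_ideal f) ('X_j - 1) 1.
  apply: contrapT => no1; have [|c cz] := weak_nullstellensatz _ no1; first exact: adjoin_ideal.
  have := cz _ (adjoin_gen ('X_j - 1) fcl); rewrite mevalB mevalXU meval1.
  rewrite (zf c) => [|k]; last by apply/cz/adjoin_sub/in_ideal_gen.
  by move/eqP; rewrite sub0r oppr_eq0 oner_eq0.
pose part n (p : {mpoly C[d]}) := mfilter (pred1 n) p.
have part_ideal n p : in_ideal f p -> in_ideal f (part n p).
  move=> [a ->]; exists (fun k => mfilter (fun l => (l + r == n)%N) (a k)).
  rewrite /part linear_sum; apply: eq_bigr => k _ /=.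
  by rewrite mulrC (mfilterM (P := fun l => (l + r == n)%N) _ (hf k)) // mulrC.
have hX : ('X_j : {mpoly C[d]}) \is 1.-homog by rewrite dhomogX /= mdeg1.
have partX n : part n.+1 ('X_j * b) = 'X_j * part n b.
  by apply: mfilterM hX _ => l; rewrite addn1.
have partX0 : part 0%N ('X_j * b) = 0.
  rewrite /part (mfilterM (P := xpred0) _ hX) => [|l]; last by rewrite addn1.
  by apply/mpolyP=> u; rewrite (_ : mfilter _ _ = 0) ?mulr0 //; apply/mpolyP=> v; rewrite mcoeff_filter mcoeff0.
have part1 n : part n (1 : {mpoly C[d]}) = (n == 0%N)%:R.
  apply/mpolyP=> u; rewrite mcoeff_filter -mpolyC_nat mcoeffC mcoeff1 -mdeg_eq0 /=.
  have [->|un] := eqVneq (mdeg u) n; first by case: (n == 0%N); rewrite ?mulr1 ?mulr0.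
  by have [n0|] := eqVneq n 0%N; rewrite ?mul0r // -n0 (negPf un) mulr0.
have bE : 1 - b * ('X_j - 1) = 1 + b - 'X_j * b by rewrite mulrBr mulr1 opprB addrA [b * _]mulrC.
have chain n : in_ideal f (part n b + 'X_j ^+ n).
  elim: n => [|n IHn].
    have := part_ideal 0%N _ bI; rewrite bE /part linearB linearD /= -!/(part _ _) partX0 subr0.
    by rewrite part1 addrC.
  have := part_ideal n.+1 _ bI; rewrite bE /part linearB linearD /= -!/(part _ _) partX part1 add0r => In.
  have := in_idealD In (in_idealM 'X_j IHn).
  by rewrite mulrDr addrA addrNK -exprS.
exists (msize b); have := chain (msize b).
rewrite (_ : part _ b = 0) ?add0r //; apply/mpolyP=> u; rewrite mcoeff_filter mcoeff0 /=.
by case: eqP => // ub; apply/memN_msupp_eq0/msize_mdeg_ge; rewrite ub.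
Qed.

End WeakNullstellensatz.

(** A countable set of reals has Lebesgue measure 0. *)
Lemma uncountable_complex (R : realType) : ~ countable [set: R[i]]%classic.
Proof.
move=> /countable_injP[e e_inj].
have : countable `[0%R, 1%R : R]%classic.
  apply/countable_injP; exists (e \o (fun x : R => x%:C%C)) => x y _ _ /= exy.
  by have := e_inj _ _ (classical_sets.in_setT _) (classical_sets.in_setT _) exy; case.
move=> /countable_lebesgue_measure0; rewrite lebesgue_measure_itv /= lte01 => /eqP.
by rewrite sube0 eqe oner_eq0.
Qed.

(** * Geometric series of a locally nilpotent map *)

Section GeometricSeries.
Variables (F : nzRingType) (V : lmodType F) (T : {linear V -> V}).
Hypothesis T_nil : forall v, exists n, geom_term T n v = 0.

Lemma geom_termS k v : geom_term T k.+1 v = - T (geom_term T k v).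
Proof. by []. Qed.

Lemma geom_term_eq0 n k v : geom_term T n v = 0 -> (n <= k)%N -> geom_term T k v = 0.
Proof.
move=> n0 /subnK <-; elim: (k - n)%N => [|l IHl] //.
by rewrite addSn geom_termS IHl linear0 oppr0.
Qed.

Lemma geom_finite_nil : geom_finite T.
Proof.
move=> v; have [n n0] := T_nil v.
apply: (sub_finite_set _ (finite_II n)) => k /= k0.
by rewrite ltnNge; apply: contra k0 => nk; rewrite (geom_term_eq0 n0 nk).
Qed.

Lemma geom_seriesE n v : geom_term T n v = 0 ->
  geom_series T v = \sum_(k < n) geom_term T k v.
Proof.
move=> n0; rewrite /geom_series (fsbigE (iota 0 n)) ?iota_uniq //.
  rewrite -(big_mkord xpredT) /index_iota subn0; apply: eq_bigl => k.
  by rewrite classical_sets.in_setT.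
by move=> k _; rewrite mem_iota /= add0n -leqNgt => /(geom_term_eq0 n0).
Qed.

Lemma geom_seriesK : cancel (geom_series T) (fun v => v + T v).
Proof.
move=> v; have [n n0] := T_nil v; rewrite (geom_seriesE n0).
have -> : T (\sum_(k < n) geom_term T k v) = - \sum_(k < n) geom_term T k.+1 v.
  by rewrite linear_sum -sumrN; apply: eq_bigr => k _; rewrite geom_termS opprK.
rewrite -sumrB -(big_mkord xpredT (fun k => geom_term T k v - geom_term T k.+1 v)).
rewrite (@telescope_sumr_eq _ 0 n (fun k => - geom_term T k v)) // => [|k _].
  by rewrite n0 oppr0 sub0r opprK.
by rewrite opprK addrC.
Qed.

(** If T w = - w then all the terms of the series of w equal w, so w = 0 by
    nilpotency. *)
Lemma one_plus_inj : injective (fun v => v + T v).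
Proof.
move=> u v /eqP; rewrite -subr_eq0 opprD addrACA -linearB; set w := u - v => /eqP w0.
have Tw : - T w = w by apply/eqP; rewrite eq_sym -addr_eq0 w0.
have iw k : geom_term T k w = w by elim: k => // k IHk; rewrite geom_termS IHk.
by have [n] := T_nil w; rewrite iw => /eqP; rewrite subr_eq0 => /eqP.
Qed.

Lemma one_plusK : cancel (fun v => v + T v) (geom_series T).
Proof. by move=> v; apply: one_plus_inj; rewrite geom_seriesK. Qed.

Lemma geom_series_linear : linear (geom_series T).
Proof.
move=> c u v; apply: one_plus_inj; rewrite geom_seriesK linearP addrACA -scalerDr.
by rewrite !geom_seriesK.
Qed.

Lemma geom_series_fix v : T v = 0 -> geom_series T v = v.
Proof. by move=> Tv; apply: one_plus_inj; rewrite geom_seriesK Tv addr0. Qed.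

End GeometricSeries.

(** * Perturbation of a contraction and the perturbed cohomology *)

Section Perturbation.
Variables (F : comNzRingType) (d : nat) (V : lmodType F).
Variables (delta eta nabla : {linear dform F d -> dform F d}).
Variables (iota : {linear V -> dform F d}) (pi : {linear dform F d -> V}).
Variable (h : {linear dform F d -> dform F d}).
Implicit Types (w : dform F d) (p : int).
Hypothesis nablaE : forall w, nabla w = delta w + eta w.
Hypothesis delta2 : forall w, delta (delta w) = 0.
Hypothesis nabla2 : forall w, nabla (nabla w) = 0.
Hypothesis eta_deg : forall p w, is_form p w -> is_form (p + 1) (eta w).
Hypothesis delta_deg : forall p w, is_form p w -> is_form (p + 1) (delta w).
Hypothesis ctr : contraction delta iota pi h.
Hypothesis nil : forall w, exists n, geom_term (eta \o h) n w = 0.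

Let S := geom_series (eta \o h).
Let A w := w + eta (h w).

Let SK : cancel S A. Proof. exact: geom_seriesK. Qed.
Let AK : cancel A S. Proof. exact: one_plusK. Qed.

Let anti w : delta (eta w) + eta (eta w) = - eta (delta w).
Proof.
have := nabla2 w; rewrite nablaE [nabla w]nablaE !linearD delta2 /= add0r => n2.
by apply/eqP; rewrite -addr_eq0 -addrA [X in _ + X]addrC n2.
Qed.

Let eta_iota v : eta (iota v) = 0.
Proof.
apply: (is_form_eq0 (eta_deg (iota_degree ctr v))).
by rewrite -PoszD addn1 !lez_nat ltnn.
Qed.

Let delta_h w : delta (h w) = w - iota (pi w) - h (delta w).
Proof. by rewrite -(contraction_homotopy ctr) addrK. Qed.

Let nablaA w : nabla (A w) = A (delta w).
Proof.
rewrite linearD nablaE [nabla (eta _)]nablaE -addrA; congr (_ + _).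
rewrite anti delta_h.
have -> : eta (w - iota (pi w) - h (delta w)) = eta w - eta (h (delta w)).
  by rewrite (linearB eta) (linearB eta) eta_iota subr0.
by rewrite subKr.
Qed.

Let S_nabla w : S (nabla w) = delta (S w).
Proof. by rewrite -{1}(SK w) nablaA AK. Qed.

(** With A = 1 + eta h and u = A^{-1} w: nabla h u = A u - iota pi u - h delta
    u, and A^{-1} nabla = delta A^{-1} because nabla A = A delta. *)
Lemma perturbed_homotopy w : nabla (h (S w)) + h (S (nabla w)) = w - iota (pi (S w)).
Proof.
rewrite S_nabla nablaE delta_h addrAC subrK addrAC.
by congr (_ - _); exact: SK.
Qed.

Lemma perturbed_pi w : pi (S (nabla w)) = 0.
Proof. by rewrite S_nabla (pi_chain ctr). Qed.

Let S_iota v : S (iota v) = iota v.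
Proof. by apply: geom_series_fix => //=; rewrite (h_iota ctr) linear0. Qed.

Let S0 : S 0 = 0.
Proof. by apply: geom_series_fix => //; exact: linear0. Qed.

Let nabla_iota v : nabla (iota v) = 0.
Proof. by rewrite nablaE eta_iota (iota_chain ctr) addr0. Qed.

Let S_deg p w : is_form p w -> is_form p (S w).
Proof.
move=> pw; have [n n0] := nil w; rewrite /S (geom_seriesE n0).
apply: is_form_sum => k _; elim: (k : nat) => // l IHl.
rewrite geom_termS; apply: is_formN; rewrite -(subrK 1 p).
by apply/eta_deg/(h_degree ctr).
Qed.

Let hS_deg p w : is_form p w -> is_form (p - 1) (h (S w)).
Proof. by move=> pw; apply/(h_degree ctr)/S_deg. Qed.

Let cocycleP p (z : cocycle nabla p) : is_form p (val z) /\ nabla (val z) = 0.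
Proof. by case: z => w /= /andP[pw /eqP]. Qed.

Let exact_of_pi0 p (z : cocycle nabla p) : pi (S (val z)) = 0 -> z \in @coboundary _ _ nabla p.
Proof.
have [pz nz] := cocycleP z => pz0; apply/asboolP; exists (h (S (val z))); first exact: hS_deg.
by have := perturbed_homotopy (val z); rewrite nz S0 (linear0 h) addr0 pz0 (linear0 iota) subr0.
Qed.

(** Outside degree d the projection vanishes, so the homotopy writes every
    cocycle as a coboundary. *)
Lemma cohomology_eq0 p (c : cohomology nabla p) : p != d%:Z -> c = 0.
Proof.
move=> pd; have [z ->] := quot_class_surj c; rewrite -(linear0 (quot_class (@coboundary _ _ nabla p))).
apply/quot_classP; rewrite subr0; apply: exact_of_pi0; have [pz _] := cocycleP z.
exact: (pi_degree ctr pd (S_deg pz)).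
Qed.

(** The isomorphism is induced by the perturbed projection; it is onto because
    the series fixes the image of iota, where h vanishes. *)
Lemma top_cohomology : linear_iso (cohomology nabla d%:Z) V.
Proof.
pose phi (z : cocycle nabla d%:Z) := pi (S (val z)).
have phi_lin : linear phi by move=> c u v; rewrite /phi linearP [S _]geom_series_linear // linearP.
pose phiL := GRing.isLinear.Build F (cocycle nabla d%:Z) V _ phi phi_lin.
apply: (@linear_iso_quot _ _ (@coboundary _ _ nabla d%:Z) _ (HB.pack phi phiL : {linear _ -> _})) => [v|z] /=.
  have iv : iota v \in cocycle_pred nabla d%:Z.
    by apply/andP; split; [exact: (iota_degree ctr) | rewrite nabla_iota].
  by exists (Cocycle iv); rewrite /phi /= S_iota (pi_iota ctr).
split; first exact: exact_of_pi0.
by move=> /asboolP[w _ nw]; rewrite /phi -nw perturbed_pi.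
Qed.

Lemma top_class w : is_form d%:Z w -> exists z z' : cocycle nabla d%:Z,
  [/\ val z = w, val z' = iota (pi (S w)) & coh_class z = coh_class z'].
Proof.
move=> dw.
have nw : nabla w = 0.
  have := is_formD (delta_deg dw) (eta_deg dw); rewrite -nablaE => /is_form_eq0; apply.
  by rewrite -PoszD addn1 !lez_nat ltnn.
have zw : w \in cocycle_pred nabla d%:Z by apply/andP; rewrite nw.
have zi : iota (pi (S w)) \in cocycle_pred nabla d%:Z.
  by apply/andP; split; [exact: (iota_degree ctr) | rewrite nabla_iota].
exists (Cocycle zw), (Cocycle zi); split=> //; apply/quot_classP/asboolP.
exists (h (S w)); first exact: hS_deg.
by rewrite -[RHS]perturbed_homotopy nw S0 linear0 addr0.
Qed.

End Perturbation.

(** * Base change of a module by generators and relations *)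

Section FreeExtension.
Variables (K : nzRingType) (V : choiceType) (W : lmodType K) (psi : V -> W).
Local Notation free_module := (@monalg.malg V K).
Local Notation gen v := (monalg.mkmalgU v 1 : free_module).

Definition free_extend (w : free_module) : W :=
  \sum_(v <- monalg.msupp w) monalg.mcoeff v w *: psi v.

Lemma free_extendE (w : free_module) (D : {fset V}) : (monalg.msupp w `<=` D)%fset ->
  free_extend w = \sum_(v <- D) monalg.mcoeff v w *: psi v.
Proof.
move=> wD; apply: big_fset_incl => // v _ vw.
by rewrite monalg.mcoeff_outdom // scale0r.
Qed.

Fact free_extend_linear : linear free_extend.
Proof.
move=> c u v; pose D := (monalg.msupp (c *: u + v) `|` (monalg.msupp u `|` monalg.msupp v))%fset.
rewrite (@free_extendE _ D) ?fsubsetUl // (@free_extendE u D) ?(@free_extendE v D).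
- rewrite scaler_sumr -big_split; apply: eq_bigr => x _ /=.
  by rewrite monalg.mcoeffD monalg.mcoeffZ scalerDl scalerA.
- by rewrite /D fsubsetU // fsubsetUr orbT.
- by rewrite /D fsubsetU // fsubsetUl orbT.
Qed.

HB.instance Definition _ := GRing.isLinear.Build K free_module W _ free_extend free_extend_linear.

Lemma free_extend_gen v : free_extend (gen v) = psi v.
Proof.
rewrite (@free_extendE _ [fset v]%fset) ?monalg.msuppU_le //.
by rewrite big_seq_fset1 monalg.mcoeffUU scale1r.
Qed.

Lemma gen_scale c v : monalg.mkmalgU v c = c *: gen v :> free_module.
Proof.
apply/monalg.malgP => k.
by rewrite monalg.mcoeffZ !monalg.mcoeffU mulrnAr mulr1.
Qed.

End FreeExtension.

Section Tensor.
Variables (F K : comNzRingType) (phi : {rmorphism F -> K}) (V : lmodType F).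
Local Notation free_module := (@monalg.malg V K).
Local Notation gen v := (monalg.mkmalgU v 1 : free_module).
Local Notation relations := (Defs.span (tensor_rel phi (V := V))).

Definition pure_tensor (v : V) : base_change phi V := quot_class relations (gen v).

Lemma relations_gen w : tensor_rel phi w -> w \in relations.
Proof.
move=> rw; apply/asboolP; exists 1%N, (fun=> 1), (fun=> w); split=> //.
by rewrite big_ord1 scale1r.
Qed.

Lemma pure_tensorD u v : pure_tensor (u + v) = pure_tensor u + pure_tensor v.
Proof.
rewrite /pure_tensor -quot_classD; apply/quot_classP/relations_gen; left; exists u, v.
by rewrite opprD addrA.
Qed.

Lemma pure_tensorZ c v : pure_tensor (c *: v) = phi c *: pure_tensor v.
Proof.
by rewrite /pure_tensor -(linearZ_LR (quot_class relations)); apply/quot_classP/relations_gen; right; exists c, v.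
Qed.

Lemma pure_tensor0 : pure_tensor 0 = 0.
Proof. by have /eqP := pure_tensorD 0 0; rewrite addr0 addrC -subr_eq subrr eq_sym => /eqP. Qed.

Lemma pure_tensor_ind (P : base_change phi V -> Prop) :
  P 0 -> (forall x y, P x -> P y -> P (x + y)) -> (forall c v, P (c *: pure_tensor v)) ->
  forall x, P x.
Proof.
move=> P0 PD PZ x; have [w ->] := quot_class_surj x.
rewrite [w]monalg.monalgE linear_sum; apply: (big_ind P) => // v _.
by rewrite gen_scale linearZ; apply: PZ.
Qed.

(** The universal property of the tensor product. *)
Lemma base_change_lift (W : lmodType K) (psi : V -> W) :
  (forall u v, psi (u + v) = psi u + psi v) -> (forall c v, psi (c *: v) = phi c *: psi v) ->
  exists Psi : {linear base_change phi V -> W}, forall v, Psi (pure_tensor v) = psi v.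
Proof.
move=> psiD psiZ.
have rel0 w : w \in relations -> free_extend psi w = 0.
  move=> /asboolP[n [c [x [xr ->]]]]; rewrite linear_sum big1 // => i _.
  rewrite (linearZ_LR (free_extend psi)) /=; suff -> : free_extend psi (x i) = 0 by rewrite scaler0.
  case: (xr i) => [[u [v ->]]|[b [v ->]]]; rewrite !(linearB (free_extend psi)) /=.
    by rewrite !free_extend_gen psiD -addrA -opprD subrr.
  by rewrite (linearZ_LR (free_extend psi)) /= !free_extend_gen psiZ subrr.
pose Psi (x : base_change phi V) := free_extend psi (repr (x : Quotient.quot (submod_pred relations))).
have PsiE w : Psi (quot_class relations w) = free_extend psi w.
  apply/eqP; rewrite -subr_eq0 -linearB; apply/eqP/rel0/quot_classP.
  by rewrite /quot_class reprK.
have Psi_lin : linear Psi.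
  move=> c x y; have [u ->] := quot_class_surj x; have [v ->] := quot_class_surj y.
  by rewrite -linearP !PsiE linearP.
pose PsiL := GRing.isLinear.Build K (base_change phi V) W _ Psi Psi_lin.
by exists (HB.pack Psi PsiL : {linear _ -> _}) => v /=; rewrite PsiE free_extend_gen.
Qed.

End Tensor.

(** * Base change of the Jacobian quotient *)

Section ScalarExtension.
Variables (F K : comNzRingType) (phi : {rmorphism F -> K}) (d : nat) (p : {mpoly F[d]}).
Local Notation J := (jacobian_quot p).
Local Notation JK := (base_change phi J).
Local Notation cl := (quot_class (jacobian_ideal p)).
Local Notation pK := (map_mpoly phi p).
Local Notation clK := (quot_class (jacobian_ideal pK)).

(** Sends x^u to the class of x^u tensored with 1. *)
Definition extend_scalars : {mpoly K[d]} -> JK :=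
  poly_extend (fun u => pure_tensor phi (cl 'X_[u])).

HB.instance Definition _ := GRing.Linear.on extend_scalars.

Lemma extend_scalars_map (f : {mpoly F[d]}) :
  extend_scalars (map_mpoly phi f) = pure_tensor phi (cl f).
Proof.
rewrite [f]mpolyE (raddf_sum (map_mpoly phi)) (linear_sum extend_scalars) (linear_sum cl).
rewrite (big_morph _ (pure_tensorD phi (V := J)) (pure_tensor0 phi J)).
apply: eq_bigr => u _ /=; rewrite map_mpolyZ map_mpolyX (linearZ_LR extend_scalars) /=.
by rewrite (linearZ_LR cl) /= pure_tensorZ /= [extend_scalars _]poly_extendX.
Qed.

Lemma extend_scalars_surj x : exists f, extend_scalars f = x.
Proof.
elim/pure_tensor_ind: x => [|_ _ [f <-] [g <-]|c v]; first by exists 0; rewrite linear0.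
  by exists (f + g); rewrite linearD.
have [f ->] := quot_class_surj v.
by exists (c *: map_mpoly phi f); rewrite (linearZ_LR extend_scalars) /= extend_scalars_map.
Qed.

Lemma mderiv_map (f : {mpoly F[d]}) j : (map_mpoly phi f)^`M(j) = map_mpoly phi f^`M(j).
Proof.
by apply/mpolyP=> u; rewrite mcoeff_deriv !mcoeff_map_mpoly mcoeff_deriv raddfMn.
Qed.

(** The reduction of a polynomial over F, viewed over K, modulo the Jacobian
    ideal over K. *)
Lemma jacobian_quot_map : exists2 psi : J -> jacobian_quot pK,
  (forall u v, psi (u + v) = psi u + psi v) /\ (forall c v, psi (c *: v) = phi c *: psi v) &
  forall f, psi (cl f) = clK (map_mpoly phi f).
Proof.
pose psi (v : J) := clK (map_mpoly phi (repr (v : Quotient.quot (submod_pred (jacobian_ideal p))))).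
have psiE f : psi (cl f) = clK (map_mpoly phi f).
  apply/quot_classP; rewrite -raddfB /=.
  set f' := repr _; have /quot_classP/asboolP[a ->] : cl f' = cl f.
    by rewrite /f' /quot_class reprK.
  apply/asboolP; exists (fun j => map_mpoly phi (a j)); rewrite raddf_sum.
  by apply: eq_bigr => j _ /=; rewrite rmorphM mderiv_map.
exists psi => //; split=> [u v|c v]; have [f ->] := quot_class_surj v.
  by have [g ->] := quot_class_surj u; rewrite -quot_classD !psiE raddfD quot_classD.
by rewrite -(linearZ_LR cl) !psiE map_mpolyZ (linearZ_LR clK) /=.
Qed.

(** The map of [jacobian_quot_map] extends to the tensor product, and
    composing this extension with [extend_scalars] gives back the class of f
    over K; so f lies in the ideal once its image vanishes. *)
Lemma extend_scalars_ker f : extend_scalars f = 0 <-> in_ideal (fun j => pK^`M(j)) f.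
Proof.
split=> [f0|[a ->]].
  have [psi [psiD psiZ] psiE] := jacobian_quot_map.
  have [Psi PsiE] := base_change_lift psiD psiZ.
  have clE : clK f = Psi (extend_scalars f).
    apply: (mpoly_linear_ext (A := clK) (A' := Psi \o extend_scalars)) => u /=.
    by rewrite [extend_scalars _]poly_extendX PsiE psiE map_mpolyX.
  have : clK f = clK 0 by rewrite clE f0 (linear0 Psi) (linear0 clK).
  by move=> /quot_classP/asboolP[b fb]; exists b; rewrite -fb subr0.
rewrite (linear_sum extend_scalars) big1 // => j _.
pose A (q : {mpoly K[d]}) := extend_scalars (q * pK^`M(j)).
have A_lin : linear A by move=> c u v; rewrite /A mulrDl -scalerAl linearP.
pose AL := GRing.isLinear.Build K {mpoly K[d]} JK _ A A_lin.
apply: (mpoly_linear_ext (A := HB.pack A AL : {linear _ -> _}) (A' := \0)) => u /=.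
rewrite /A; have -> : 'X_[u] * pK^`M(j) = map_mpoly phi ('X_[u] * p^`M(j)).
  by rewrite rmorphM /= map_mpolyX mderiv_map.
rewrite extend_scalars_map -(pure_tensor0 phi J); congr pure_tensor.
rewrite -(linear0 cl); apply/quot_classP; rewrite subr0; apply/asboolP.
exact: in_idealM (in_ideal_gen _ j).
Qed.

End ScalarExtension.

(** * How the perturbation changes polynomial degree *)

Section PolynomialDegree.
Variables (F : comNzRingType) (d : nat).
Implicit Types (w : dform F d) (f : 'I_d -> {mpoly F[d]}).

Lemma koszulDl f g w : koszul (fun j => f j + g j) w = koszul f w + koszul g w.
Proof. by rewrite /koszul -big_split; apply: eq_bigr => j _; rewrite fscaleDl. Qed.

Lemma koszulNl f w : koszul (fun j => - f j) w = - koszul f w.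
Proof.
rewrite /koszul -sumrN; apply: eq_bigr => j _; apply/ffunP=> S.
by rewrite formNE !fscaleE mulNr.
Qed.

Lemma eq_koszul f g w : f =1 g -> koszul f w = koszul g w.
Proof. by move=> fg; apply: eq_bigr => j _; rewrite fg. Qed.

Lemma deg_lt_sum n (I : Type) (s : seq I) (w : I -> dform F d) :
  (forall i, deg_lt n (w i)) -> deg_lt n (\sum_(i <- s) w i).
Proof. by move=> wn; rewrite /deg_lt linear_sum; apply: eq_bigr => i _; exact: wn. Qed.

Lemma deg_ltD n w w' : deg_lt n w -> deg_lt n w' -> deg_lt n (w + w').
Proof. by move=> wn wn'; rewrite /deg_lt linearD /= wn wn'. Qed.

Lemma deg_ltN n w : deg_lt n w -> deg_lt n (- w).
Proof. by move=> wn; rewrite /deg_lt linearN /= wn. Qed.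

Lemma deg_lt_wedge_dx n j w : deg_lt n w -> deg_lt n (wedge (dx j) w).
Proof.
move=> /deg_ltP wn; apply/deg_ltP=> S u nu; rewrite wedge_dxE; case: ifP; rewrite ?mcoeff0 //.
have -> : (-1) ^+ below j S = ((-1) ^+ below j S)%:MP :> {mpoly F[d]}.
  by rewrite rmorphXn rmorphN rmorph1.
by rewrite mcoeffCM wn // mulr0.
Qed.

Lemma deg_lt_ext_d n w : deg_lt n w -> deg_lt n (ext_d w).
Proof.
move=> /deg_ltP wn; apply: deg_lt_sum => j; apply/deg_lt_wedge_dx/deg_ltP => S u nu.
by rewrite ffunE mcoeff_deriv wn ?mul0rn // mdegD (leq_trans nu) ?leq_addr.
Qed.

Lemma deg_lt_koszul_raise n s f w :
  (forall j (u : 'X_{1..d}), (s < mdeg u)%N -> (f j)@_u = 0) ->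
  deg_lt n w -> deg_lt (n + s) (koszul f w).
Proof.
move=> fs wn; apply: deg_lt_sum => j; have /deg_ltP ew := deg_lt_wedge_dx j wn.
apply/deg_ltP => S u nu; rewrite fscaleE; apply: mcoeffM_eq0 => u1 u2 eu.
have [su|us] := ltnP s (mdeg u1); first by rewrite fs // mul0r.
rewrite ew ?mulr0 // -(leq_add2r s) (leq_trans nu) // eu mdegD addnC leq_add2l //.
Qed.

Lemma is_form_vol : is_form d%:Z (vol : dform F d).
Proof.
have H (s : seq 'I_d) : is_form (size s)%:Z (\big[@wedge F d/form0 1]_(j <- s) dx j : dform F d).
  elim: s => [|j s IHs].
    rewrite big_nil; apply/is_formP => S S0; rewrite ffunE; case: eqP => // eS.
    by rewrite eS cards0 in S0.
  by rewrite big_cons /= -addn1 PoszD; apply: is_form_wedge_dx.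
have := H (index_enum 'I_d); rewrite (_ : size _ = d) //.
by rewrite -[RHS]card_ord cardE enumT.
Qed.

End PolynomialDegree.

Lemma dhomog_coef (F : comNzRingType) (d r : nat) (p : {mpoly F[d]}) :
  (forall u, mdeg u != r -> p@_u = 0) -> p \is r.-homog.
Proof.
move=> pr; apply/dhomogP => u; rewrite mcoeff_msupp => pu /=.
by apply/eqP; apply: contraNT pu => /pr ->.
Qed.

Lemma dhomog_mderiv (F : comNzRingType) (d r : nat) (p : {mpoly F[d]}) j :
  p \is r.+1.-homog -> p^`M(j) \is r.-homog.
Proof.
move=> hp; apply: dhomog_coef => u ur.
by rewrite mcoeff_deriv (dhomog_nemf_coeff hp) ?mul0rn //= mdegD mdeg1 addn1.
Qed.

Lemma dhomog_map (F K : comNzRingType) (phi : {rmorphism F -> K}) (d r : nat) (p : {mpoly F[d]}) :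
  p \is r.-homog -> map_mpoly phi p \is r.-homog.
Proof.
move=> hp; apply: dhomog_coef => u ur.
by rewrite mcoeff_map_mpoly (dhomog_nemf_coeff hp ur) raddf0.
Qed.

(** * The twisted differential of a polynomial phase *)

Section Twist.
Variables (R : realType) (d : nat).
Implicit Types (P Pm : {mpoly R[i][d]}) (w : dform (ratfun R) d).

Lemma it_neq0 : it R != 0.
Proof.
rewrite /it mulf_neq0 //; last by rewrite tofrac_eq0 polyX_eq0.
by rewrite /ratfun_const /= tofrac_eq0 polyC_eq0 eq_complex /= oner_eq0 andbF.
Qed.

Lemma delta0E Pm w : delta0 Pm w = koszul (fun j => it R *: (mpolyK Pm)^`M(j)) w.
Proof.
rewrite /delta0 wedgeZl wedge_ext_d_form0 /koszul scaler_sumr; apply: eq_bigr => j _.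
by apply/ffunP=> S; rewrite formZE !fscaleE scalerAl.
Qed.

(** The one-form whose wedge product is the part of the perturbation without
    derivatives. *)
Definition eta_coef P Pm j : {mpoly (ratfun R)[d]} :=
  - 'X_j + it R *: (mpolyK (P - Pm))^`M(j).

Lemma eta_opE P Pm w : eta_op P Pm w = ext_d w + koszul (eta_coef P Pm) w.
Proof.
rewrite /eta_op koszulDl koszulNl -addrA -(delta0E (P - Pm)) /delta0; congr (_ + (- _ + _)).
by apply: eq_bigr => j _; rewrite wedge_fscalel.
Qed.

Fact eta_op_linear P Pm : linear (eta_op P Pm).
Proof.
by move=> c u v; rewrite !eta_opE (linearP (@ext_d _ d)) (linearP (koszul _)) scalerDr addrACA.
Qed.

HB.instance Definition _ P Pm := GRing.isLinear.Build (ratfun R) (dform (ratfun R) d)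
  (dform (ratfun R) d) _ (eta_op P Pm) (eta_op_linear P Pm).

Lemma is_form_eta P Pm (p : int) w : is_form p w -> is_form (p + 1) (eta_op P Pm w).
Proof.
by move=> pw; rewrite eta_opE; apply: is_formD; [apply: is_form_ext_d | apply: is_form_koszul].
Qed.

(** The factor 1/2 of the quadratic part cancels the 2 of its derivative. *)
Lemma mderiv_phase P Pm j :
  (phase P)^`M(j) = it R *: (mpolyK Pm)^`M(j) + eta_coef P Pm j.
Proof.
rewrite /phase /eta_coef.
have -> : mpolyK P = mpolyK Pm + mpolyK (P - Pm) by rewrite /mpolyK -raddfD addrC subrK.
move: (mpolyK Pm) (mpolyK (P - Pm)) => A B.
rewrite scalerDr [LHS]mderivD (mderivD j (it R *: A)) 3!mderivZ [LHS]addrCA.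
congr (_ + (_ + _)).
have dX k : ('X_k : {mpoly (ratfun R)[d]})^`M(j) = (k == j)%:R.
  rewrite mderivX mnm1E; case: eqP => [->|_]; last by rewrite scale0r.
  by rewrite scale1r (_ : (U_(j) - U_(j))%MM = 0%MM) ?mpolyX0 //; apply/mnmP=> l; rewrite !mnmE subnn.
have dX2 k : ('X_k ^+ 2 : {mpoly (ratfun R)[d]})^`M(j) = if k == j then 2%:R *: 'X_j else 0.
  rewrite expr2 mderivM dX; case: eqP => [->|_]; last by rewrite mul0r mulr0 addr0.
  by rewrite mul1r mulr1 scaler_nat mulr2n.
have -> : (quadratic R d)^`M(j) = \sum_(k < d) (if k == j then 2%:R *: 'X_j else 0).
  by rewrite /quadratic raddf_sum; apply: eq_bigr => k _; exact: dX2.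
rewrite -big_mkcond big_pred1_eq.
rewrite scalerA mulNr mulVf ?scaleN1r //.
by rewrite -(rmorph_nat (@ratfun_const R)) fmorph_eq0 Num.Theory.pnatr_eq0.
Qed.

Lemma nablaE P Pm w :
  nabla P w = koszul (fun j => it R *: (mpolyK Pm)^`M(j)) w + eta_op P Pm w.
Proof.
rewrite eta_opE addrCA -koszulDl /nabla /= /twisted_d wedge_ext_d_form0; congr (_ + _).
by apply: eq_koszul => j; exact: mderiv_phase.
Qed.

End Twist.

Section TwistedComplex.
Variables (R : realType) (d m : nat) (P : {mpoly R[i][d]}) (Pk : nat -> {mpoly R[i][d]}).
Hypothesis m_ge3 : (3 <= m)%N.
Hypothesis Pk_homog : forall k, (k <= m)%N -> Pk k \is k.-homog.
Hypothesis P_sum : P = \sum_(k < m.+1) Pk k.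
Hypothesis Pm_crit : forall x : 'I_d -> R[i],
        (forall j : 'I_d, (Pk m)^`M(j).@[x] = 0) -> forall j : 'I_d, x j = 0.

Local Notation K := (ratfun R).
Let Pm := Pk m.
Let f (j : 'I_d) : {mpoly R[i][d]} := Pm^`M(j).
Let fK (j : 'I_d) : {mpoly K[d]} := it R *: (mpolyK Pm)^`M(j).

Let m_pred : m = m.-1.+1. Proof. by rewrite prednK // (leq_trans _ m_ge3). Qed.

Let f_homog j : f j \is m.-1.-homog.
Proof. by apply: dhomog_mderiv; rewrite -m_pred; apply: Pk_homog. Qed.

Let fK_homog j : fK j \is m.-1.-homog.
Proof. by apply/dhomogZ/dhomog_mderiv; rewrite -m_pred; apply/dhomog_map/Pk_homog. Qed.

Let f_power : exists N, forall j, in_ideal f ('X_j ^+ N).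
Proof. exact: (homog_nullstellensatz (@uncountable_complex R) f_homog Pm_crit). Qed.

Let fK_ideal p : in_ideal fK p <-> in_ideal (fun j => (mpolyK Pm)^`M(j)) p.
Proof.
split=> -[a ->]; first by exists (fun j => it R *: a j); apply: eq_bigr => j _; rewrite /fK -scalerAr scalerAl.
exists (fun j => (it R)^-1 *: a j); apply: eq_bigr => j _.
by rewrite /fK -scalerAr -scalerAl scalerA mulfV ?scale1r // it_neq0.
Qed.

Let fK_power : exists N, forall j, in_ideal fK ('X_j ^+ N).
Proof.
have [N XN] := f_power; exists N => j; apply/fK_ideal; have [a aE] := XN j.
exists (fun k => mpolyK (a k)).
have -> : 'X_j ^+ N = mpolyK ('X_j ^+ N) :> {mpoly K[d]}.
  by rewrite /mpolyK rmorphXn /= map_mpolyX.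
rewrite aE /mpolyK raddf_sum; apply: eq_bigr => k _ /=.
by rewrite rmorphM mderiv_map.
Qed.

Let eta_coef_deg j (u : 'X_{1..d}) : (m.-2 < mdeg u)%N -> (eta_coef P Pm j)@_u = 0.
Proof.
move=> um; have m2 : (0 < m.-2)%N by case: (m) m_ge3 => [|[|[|]]].
rewrite /eta_coef mcoeffD mcoeffN mcoeffX mcoeffZ mcoeff_deriv mcoeff_map_mpoly.
rewrite (_ : (_ == u) = false) ?oppr0 ?add0r; last first.
  by apply: contraTF um => /eqP <-; rewrite mdeg1 -leqNgt.
rewrite P_sum big_ord_recr /= addrK raddf_sum big1 ?raddf0 ?mul0rn ?mulr0 //= => k _.
apply: (dhomog_nemf_coeff (Pk_homog (ltnW (ltn_ord k)))).
rewrite /= mdegD mdeg1 addn1 neq_ltn (leq_trans (ltn_ord k)) ?orbT //.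
by rewrite -ltnS in um; rewrite m_pred; apply: leq_trans um; case: (m) m_ge3 => [|[|]].
Qed.

Let eta_raise n w : deg_lt n w -> deg_lt (n + m.-2) (eta_op P Pm w).
Proof.
move=> wn; rewrite eta_opE; apply: deg_ltD; last exact: deg_lt_koszul_raise eta_coef_deg wn.
by apply: deg_lt_le (deg_lt_ext_d wn); rewrite leq_addr.
Qed.

Let eta_h_nil (h : {linear dform K d -> dform K d}) w : lowers_degree_by m.-1%:Z h ->
  exists n, geom_term (eta_op P Pm \o h) n w = 0.
Proof.
move=> hlow.
(* Either h lowers the degree by m - 1 and eta raises it by m - 2, or h v = 0. *)
have step n v : deg_lt n v -> deg_lt n.-1 (eta_op P Pm (h v)).
  move=> vn; have hn := lowers_deg_lt hlow vn.
  have [mn|nm] := leqP m.-1 n.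
    apply: deg_lt_le (eta_raise hn); move: mn; case: (m) m_ge3 => [|[|k]] //= _ kn.
    by rewrite -{2}(subnK kn) addnS.
  have -> : h v = 0 by apply: deg_lt0; rewrite (eqP (ltnW nm : (n - m.-1 == 0)%N)) in hn.
  rewrite linear0; apply/deg_ltP=> S u _; rewrite form0E mcoeff0 //.
have [n wn] := deg_lt_exists w; exists n; apply: deg_lt0.
have : forall k, deg_lt (n - k) (geom_term (eta_op P Pm \o h) k w).
  elim=> [|k IHk]; first by rewrite subn0.
  by rewrite subnS; apply/deg_ltN/step.
by move=> /(_ n); rewrite subnn.
Qed.

Lemma has_dim_jacobian : has_dim (jacobian_quot Pm) (m.-1 ^ d).
Proof.
have [N XN] := f_power; apply: has_dim_quot.
have [phi phi_surj phi_ker] := codim_ideal f_homog XN.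
by exists phi => // p; rewrite phi_ker; split=> [|/asboolP//]; move/asboolP.
Qed.

Section Target.
Variables (V : lmodType K) (tau : {linear {mpoly K[d]} -> V}).
Hypothesis tau_surj : forall v, exists p, tau p = v.
Hypothesis tau_ker : forall p, tau p = 0 <-> in_ideal (fun j => (mpolyK Pm)^`M(j)) p.

Let tau_kerK p : tau p = 0 <-> in_ideal fK p.
Proof. by rewrite fK_ideal. Qed.

Lemma has_dim_target : has_dim V (m.-1 ^ d).
Proof.
have [N XN] := fK_power; have [phi phi_surj phi_ker] := codim_ideal fK_homog XN.
apply: (linear_iso_ker (phi := tau) (psi := phi)) => //.
by move=> p; rewrite phi_ker.
Qed.

Lemma delta0_contraction :
  exists (iota : {linear V -> dform K d}) (pi : {linear dform K d -> V})
         (h : {linear dform K d -> dform K d}),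
    contraction (delta0 Pm) iota pi h /\ lowers_degree_by (m%:Z - 1) h.
Proof.
have -> : m%:Z - 1 = m.-1%:Z by rewrite {1}m_pred -addn1 PoszD addrK.
have -> : delta0 Pm = koszul fK by apply/funext => w; exact: delta0E.
have [N XN] := fK_power.
exact: (@koszul_contraction K d m.-1 N fK fK_homog XN V tau tau_surj tau_kerK).
Qed.

(** Stated for any quotient V of K[x] by the Jacobian ideal, so that the proof
    never meets the construction of the tensor product. *)
Lemma perturbed_reduction :
  let mu := (m.-1 ^ d)%N in
  let Omega := dform (ratfun R) d in
  let H := cohomology (nabla P) in
  [/\ has_dim (jacobian_quot Pm) mu,
      exists (iota : {linear V -> Omega}) (pi : {linear Omega -> V})
             (h : {linear Omega -> Omega}),
        let eta_h := eta_op P Pm \o h in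
        let one_plus_eta_h := fun w : Omega => w + eta_h w in
        let pi_P := pi \o geom_series eta_h in
        let h_P := h \o geom_series eta_h in
        [/\ contraction (delta0 Pm) iota pi h /\ lowers_degree_by (m%:Z - 1) h,
            geom_finite eta_h,
            cancel one_plus_eta_h (geom_series eta_h) /\
            cancel (geom_series eta_h) one_plus_eta_h,
            (forall w : Omega, nabla P (h_P w) + h_P (nabla P w) = w - iota (pi_P w)) /\
            (forall w : Omega, pi_P (nabla P w) = 0)
          & forall f : {mpoly (ratfun R)[d]},
              exists z z' : cocycle (nabla P) d,
                [/\ val z = fscale f vol,
                    val z' = iota (pi_P (fscale f vol))
                  & coh_class z = coh_class z']],
      forall p : int, p != d -> forall c : H p, c = 0,
      linear_iso (H d) V
    & has_dim (H d) mu].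
Proof.
move=> mu Omega H.
have [iota [pi [h [ctr hlow]]]] := delta0_contraction.
have hlow' : lowers_degree_by m.-1%:Z h by move: hlow; rewrite {1}m_pred -addn1 PoszD addrK.
have nil w := eta_h_nil w hlow'.
have ctrK : contraction (koszul fK) iota pi h.
  by rewrite (_ : koszul fK = delta0 Pm :> (_ -> _)) //; apply/funext => w; rewrite delta0E.
have nE w : nabla P w = koszul fK w + eta_op P Pm w by exact: nablaE.
have k2 := koszul_koszul fK; have n2 := twisted_d_twisted_d (phase P).
have ed := @is_form_eta R d P Pm.
have kd p w : is_form p w -> is_form (p + 1) (koszul fK w) by exact: is_form_koszul.
have iso := top_cohomology nE k2 n2 ed ctrK nil.
split.
- exact: has_dim_jacobian.
- exists iota, pi, h; split=> //.
  + exact: geom_finite_nil nil.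
  + by split; [exact: one_plusK nil | exact: geom_seriesK nil].
  + split=> w; [exact: (perturbed_homotopy nE k2 n2 ed ctrK nil)|].
    exact: (perturbed_pi nE k2 n2 ed ctrK nil).
  + by move=> g; apply: (top_class nE k2 n2 ed kd ctrK nil); apply/is_form_fscale/is_form_vol.
- by move=> p pd c; exact: (cohomology_eq0 nE k2 n2 ed ctrK nil).
- exact: iso.
- exact: linear_iso_trans iso has_dim_target.
Qed.

End Target.

End TwistedComplex.

Theorem theorem5p1 (R : realType) (d m : nat)
    (P : {mpoly R[i][d]}) (Pk : nat -> {mpoly R[i][d]})
    (m_ge3 : (3 <= m)%N)
    (Pk_homog : forall k, (k <= m)%N -> Pk k \is k.-homog)
    (P_sum : P = \sum_(k < m.+1) Pk k)
    (Pm_crit : forall x : 'I_d -> R[i],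
        (forall j : 'I_d, (Pk m)^`M(j).@[x] = 0) -> forall j : 'I_d, x j = 0) :
  let Pm := Pk m in
  let J := jacobian_quot Pm in
  let JK := base_change (@ratfun_const R) J in
  let mu := (m.-1 ^ d)%N in
  let Omega := dform (ratfun R) d in
  let H := cohomology (nabla P) in
  [/\ has_dim J mu,
      exists (iota : {linear JK -> Omega}) (pi : {linear Omega -> JK})
             (h : {linear Omega -> Omega}),
        let eta_h := eta_op P Pm \o h in
        let one_plus_eta_h := fun w : Omega => w + eta_h w in
        let pi_P := pi \o geom_series eta_h in
        let h_P := h \o geom_series eta_h in
        [/\ contraction (delta0 Pm) iota pi h /\ lowers_degree_by (m%:Z - 1) h,
            geom_finite eta_h,
            cancel one_plus_eta_h (geom_series eta_h) /\
            cancel (geom_series eta_h) one_plus_eta_h,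
            (forall w : Omega, nabla P (h_P w) + h_P (nabla P w) = w - iota (pi_P w)) /\
            (forall w : Omega, pi_P (nabla P w) = 0)
          & forall f : {mpoly (ratfun R)[d]},
              exists z z' : cocycle (nabla P) d,
                [/\ val z = fscale f vol,
                    val z' = iota (pi_P (fscale f vol))
                  & coh_class z = coh_class z']],
      forall p : int, p != d -> forall c : H p, c = 0,
      linear_iso (H d) JK
    & has_dim (H d) mu].
Proof.
have surj := @extend_scalars_surj _ _ (@ratfun_const R) d (Pk m).
have ker := @extend_scalars_ker _ _ (@ratfun_const R) d (Pk m).
have thm := perturbed_reduction m_ge3 Pk_homog P_sum Pm_crit surj ker.
(* The structures on the two sides are convertible but not syntactically equal;
   kernel conversion decides this at once, unification does not. *)
exact_no_check thm.
Qed.
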